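(* Let $(X,d_X)$ and $(Y,d_Y)$ be metric spaces and let $\phi:(X,d_X)\to(Y,d_Y)$ be an $\epsilon$-quasi-isometry. Let $\lambda$ be either Rips persistence (RP) or Čech persistence (CP). Then for all subsets $S\subseteq X$, $$d_B(\lambda(S),\lambda(\phi(S)))\le \epsilon .$$
   Context: A map $\phi:(X,d_X)\to(Y,d_Y)$ is an $\epsilon$-quasi-isometry if $|d_X(x_1,x_2)-d_Y(\phi(x_1),\phi(x_2))|\le\epsilon$ for all $x_1,x_2\in X$ (no surjectivity is required). Subsets $S\subseteq X$ and $\phi(S)\subseteq Y$ carry the restricted metrics and are regarded as metric spaces in their own right. For a metric space $S$, the Rips filtration contains a nonempty finite subset $\sigma\subseteq S$ as a simplex at parameter $r$ iff $d(x,y)\le r$ for all $x,y\in\sigma$. The (intrinsic) Čech filtration contains $\sigma$ at parameter $r$ iff the closed balls of radius $r$ in $S$ centered at the points of $\sigma$ have a common point of $S$. $\mathrm{RP}(S)$ (resp. $\mathrm{CP}(S)$) is the collection of persistence diagrams, one for every homological degree (homology with coefficients in a fixed field), of the Rips (resp. Čech) filtration of $S$. $d_B$ is the bottleneck distance (with $\ell^\infty$ ground metric, points may be matched to the diagonal), maximized over all homological degrees. The statement concerns subsets $S$ for which the persistence diagrams of $S$ and $\phi(S)$ are defined, in particular all finite subsets. *)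

(* Defs.v *)
From HB Require Import structures.
From mathcomp Require Import all_boot all_order all_algebra all_fingroup finmap.
From mathcomp Require Import all_classical all_reals all_analysis.

Set Implicit Arguments.
Unset Strict Implicit.
Unset Printing Implicit Defensive.

Import Order.TTheory GRing.Theory Num.Theory.

Local Open Scope classical_set_scope.
Local Open Scope ring_scope.

Definition quasi_isometry (R : realType) (X Y : metricType R) (eps : R)
    (phi : X -> Y) : Prop :=
  forall x1 x2 : X, `|mdist x1 x2 - mdist (phi x1) (phi x2)| <= eps.

(** * Rips and Cech filtrations *)

(* A family of abstract simplicial complexes, given by their simplices. *)
Definition filtration (R : realType) (T : choiceType) := R -> set {fset T}.

(* A subset [S] of [X] is the metric space with the restricted distance: only
   points of [S] are used, both as vertices and, in the Cech case, as common
   points of the balls. *)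
Definition rips (R : realType) (X : metricType R) (S : set X) :
    filtration R X :=
  fun r => [set sigma : {fset X} |
    [/\ sigma != fset0, [set` sigma] `<=` S &
        forall x y : X, x \in sigma -> y \in sigma -> mdist x y <= r]].

Definition cech (R : realType) (X : metricType R) (S : set X) :
    filtration R X :=
  fun r => [set sigma : {fset X} |
    [/\ sigma != fset0, [set` sigma] `<=` S &
        exists2 z : X, S z & forall x : X, x \in sigma -> mdist x z <= r]].

Variant filtration_kind := Rips | Cech.

Definition filtration_of (lambda : filtration_kind) (R : realType)
    (X : metricType R) (S : set X) : filtration R X :=
  match lambda with Rips => rips S | Cech => cech S end.

(** * Simplicial homology with coefficients in a field *)

Section Homology.
Variables (F : fieldType) (T : choiceType).
Implicit Types (K : set {fset T}) (k : nat).

(* An oriented k-chain is a finitely supported function on oriented k-simplices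
   that changes sign with the orientation. It is encoded by its values
   on ordered simplices, i.e. on duplicate-free (k+1)-tuples of vertices: an
   alternating function, extended by 0 to all other tuples. The value of [c] at
   (x_0, ..., x_k) is the coefficient of [x_0, ..., x_k] in [c]. *)
Definition chains K k : set (k.+1.-tuple T -> F^o) :=
  [set c : k.+1.-tuple T -> F^o | [/\ finite_set [set x | c x != 0],
      forall x, c x != 0 -> uniq x /\ K [fset v in tval x]%fset &
      forall (s : 'S_k.+1) x,
        c [tuple tnth x (s i) | i < k.+1] = (-1) ^+ s * c x]].
Arguments chains K k _ : clear implicits.

(* The boundary d[v_0, ..., v_k] = \sum_i (-1)^i [v_0, .., ^v_i, .., v_k], read
   off on coefficients: since
   [v_i, v_0, .., ^v_i, .., v_k] = (-1)^i [v_0, ..., v_k],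
   the coefficient of [x_0, ..., x_(k-1)] in [d c] is the sum over all vertices
   v of the coefficient of [v, x_0, ..., x_(k-1)] in [c]. *)
Definition boundary k (c : k.+2.-tuple T -> F^o) : k.+1.-tuple T -> F^o :=
  fun x => \sum_(v \in [set: T]) c [tuple of v :: x].

(* Homology is not reduced: every 0-chain is a cycle. *)
Definition cycles K k : set (k.+1.-tuple T -> F^o) :=
  match k with
  | 0 => chains K 0
  | k'.+1 => [set c : k'.+2.-tuple T -> F^o |
      chains K k'.+1 c /\ boundary c = (fun=> 0)]
  end.

Definition boundaries K k : set (k.+1.-tuple T -> F^o) :=
  [set boundary c | c in chains K k.+1].

End Homology.

(** * Ranks of the maps H_k(K_s) -> H_k(K_t) *)

Section DimMod.
Variables (F : fieldType) (V : lmodType F).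

Definition free_mod (B : set V) (n : nat) (z : 'I_n -> V) : Prop :=
  forall a : 'I_n -> F, B (\sum_i a i *: z i) -> forall i, a i = 0.

(* For subspaces [Z] and [B], the image of [Z] in V / B has dimension >= n. *)
Definition dim_mod_ge (Z B : set V) (n : nat) : Prop :=
  exists z : 'I_n -> V, (forall i, Z (z i)) /\ free_mod B z.

End DimMod.

(* The rank of H_k(K_s) -> H_k(K_t), s <= t, is the dimension of the image of
   the cycles of K_s in H_k(K_t) = Z_k(K_t) / B_k(K_t). *)
Definition rank_ge (F : fieldType) (R : realType) (T : choiceType)
    (K : filtration R T) (k : nat) (s t : R) (n : nat) : Prop :=
  dim_mod_ge (@cycles F T (K s) k) (@boundaries F T (K t) k) n.

(* Meaningful only when the rank is finite. *)
Definition homology_rank (F : fieldType) (R : realType) (T : choiceType)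
    (K : filtration R T) (k : nat) (s t : R) : nat :=
  xget 0%N [set n | rank_ge F K k s t n /\ ~ rank_ge F K k s t n.+1].

(* Persistence diagrams are defined for q-tame persistent homology, i.e. when
   H_k(K_s) -> H_k(K_t) has finite rank for all s < t and all degrees k; this
   is the case in particular when there are finitely many vertices. *)
Definition diagrams_defined (F : fieldType) (R : realType) (T : choiceType)
    (K : filtration R T) : Prop :=
  forall (k : nat) (s t : R), s < t -> exists n, ~ rank_ge F K k s t n.

(** * Persistence diagrams *)

(* A multiset of points (birth, death), given by its multiplicity function.
   Births are finite because the complexes above are empty at negative
   parameters. *)
Definition diagram (R : realType) := (R * \bar R)%type -> nat.

(* The least element of [A], and 0 when [A] is empty. *)
Definition min_nat (A : set nat) : nat :=
  xget 0%N [set n | A n /\ forall m, A m -> (n <= m)%N].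

(* The multiplicity of a point is the least measure of a rectangle having it
   in its interior, where the measure of [a1, a2] x [c1, c2], with a2 < c1, is
   r(a2, c1) - r(a1, c1) - r(a2, c2) + r(a1, c2), and r(_, +oo) = 0. This measure
   is nonnegative for the rank function r of a q-tame persistence module, so
   that the truncated subtractions are exact. A point with death <= birth is
   in no such rectangle, hence has multiplicity 0. *)
Definition diagram_of_rank (R : realType) (r : R -> R -> nat) : diagram R :=
  fun p => match p.2 with
  | d%:E => min_nat [set m | exists a1 a2 c1 c2 : R,
      [/\ a1 < p.1 < a2, a2 < c1, c1 < d < c2 &
          m = (r a2 c1 + r a1 c2 - (r a1 c1 + r a2 c2))%N]]
  | +oo%E => min_nat [set m | exists a1 a2 c1 : R,
      [/\ a1 < p.1 < a2, a2 < c1 & m = (r a2 c1 - r a1 c1)%N]]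
  | -oo%E => 0%N
  end.

(* One diagram for each homological degree. *)
Definition persistence (F : fieldType) (R : realType) (T : choiceType)
    (K : filtration R T) : nat -> diagram R :=
  fun k => diagram_of_rank (homology_rank F K k).

(** * Bottleneck distance *)

Section Bottleneck.
Variable R : realType.
Implicit Types (D : diagram R) (p q : R * \bar R).

(* Two points with death +oo are at finite distance. *)
Definition death_dist (x y : \bar R) : \bar R :=
  if x == y then 0%E else `|x - y|%E.

Definition linf_dist p q : \bar R :=
  maxe `|p.1 - q.1|%:E (death_dist p.2 q.2).

Definition diagonal_dist p : \bar R := ((p.2 - p.1%:E) * 2^-1%:E)%E.

(* The points of a diagram, counted with multiplicity. *)
Definition point D := {p : (R * \bar R)%type & 'I_(D p)}.

(* [M] is a partial matching; unmatched points go to the diagonal. *)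
Definition is_matching (delta : R) D1 D2 (M : point D1 -> point D2 -> Prop) :
    Prop :=
  [/\ (forall x y y', M x y -> M x y' -> y = y') /\
      (forall x x' y, M x y -> M x' y -> x = x'),
      forall x y, M x y -> (linf_dist (tag x) (tag y) <= delta%:E)%E,
      forall x, (forall y, ~ M x y) -> (diagonal_dist (tag x) <= delta%:E)%E &
      forall y, (forall x, ~ M x y) -> (diagonal_dist (tag y) <= delta%:E)%E].

Definition bottleneck D1 D2 : \bar R :=
  ereal_inf [set delta%:E | delta in [set delta : R |
    0 <= delta /\ exists M, @is_matching delta D1 D2 M]].

Definition bottleneck_all (L1 L2 : nat -> diagram R) : \bar R :=
  ereal_sup (range (fun k => bottleneck (L1 k) (L2 k))).

End Bottleneck.

(* Main.v *)
Require Import Defs.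
From mathcomp Require Import all_boot all_order all_algebra all_fingroup finmap.
From mathcomp Require Import all_classical all_reals all_analysis.
From mathcomp Require Import zify ring lra.

(** Ranks alone suffice: no interval decomposition or interpolation is needed.
    Pulling the filtration N of phi(S) back to S along phi does not change the
    ranks of its homology, since points with the same image can be merged one
    after the other; and now M_r <= N_(r + eps) <= M_(r + 2 eps), where M is the
    filtration of S. Let I_r be the image of H(M_r) -> H(N_(r + eps)), with
    ranks r_I(a, c) = rank (H(M_a) -> H(N_(c + eps))). As H(M) maps onto I, bars
    of M and I with the same birth are matched in decreasing order of death; as
    I embeds into H(N) shifted by eps, bars of I and N with the same death are
    matched in increasing order of birth (induced matchings of Bauer and
    Lesnick). All comparisons needed are instances of Frobenius' inequality
    rk(A -> C) + rk(B -> D) <= rk(B -> C) + rk(A -> D) for A -> B -> C -> D. *)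

Set Implicit Arguments.
Unset Strict Implicit.
Unset Printing Implicit Defensive.

Import Order.TTheory GRing.Theory Num.Theory.

Local Open Scope classical_set_scope.
Local Open Scope ring_scope.

(** * Ranks modulo a subspace *)

Section Rank.
Variables (F : fieldType) (V : lmodType F).
Implicit Types (Z B : set V) (m n : nat).

(** The diagrams may be infinite: points can accumulate at the diagonal, so the bars cannot be
    listed once and for all. But at a parameter after [b] only finitely many bars born at [b] are
    alive, so these bars can be numbered starting from the longest; bars with a given death are
    numbered likewise starting from the earliest birth. Bars with equal numbers correspond, and
    every property of the matching follows from inequalities between numbers of bars alive at a
    parameter. These numbers, like the multiplicities, are limits of differences of ranks; being
    natural numbers, the limits are attained. The other obstacle is that [phi] may identify points
    at distance at most [eps], so that S and phi(S) have different vertices and their complexes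
    cannot be nested. After the pull-back both filtrations consist of subcomplexes of the full
    simplex on S. The interleaving maps become inclusions, and every rank is the dimension of a
    space of cycles modulo a space of boundaries inside one space of functions. *)

Definition is_subspace B := B 0 /\ forall a u v, B u -> B v -> B (a *: u + v).

Lemma is_subspaceD B u v : is_subspace B -> B u -> B v -> B (u + v).
Proof. by move=> [_ h] Bu Bv; rewrite -[u]scale1r; apply: h. Qed.

Lemma is_subspaceZ B a u : is_subspace B -> B u -> B (a *: u).
Proof. by move=> [h0 h] Bu; rewrite -[_ *: _]addr0; apply: h. Qed.

Lemma is_subspaceB B u v : is_subspace B -> B u -> B v -> B (u - v).
Proof.
by move=> [_ h] Bu Bv; rewrite addrC -scaleN1r; apply: h.
Qed.

Lemma is_subspace_sum B n (u : 'I_n -> V) : is_subspace B ->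
  (forall i, B (u i)) -> B (\sum_i u i).
Proof.
move=> sB Bu; elim/big_ind: _ => //; first by case: sB.
by move=> x y; apply: is_subspaceD.
Qed.

Definition fcat m n (u : 'I_m -> V) (v : 'I_n -> V) (i : 'I_(m + n)) : V :=
  match fintype.split i with inl j => u j | inr j => v j end.

Lemma sum_fcat m n (u : 'I_m -> V) (v : 'I_n -> V) (a : 'I_(m + n) -> F) :
  \sum_i a i *: fcat u v i =
  \sum_i a (lshift n i) *: u i + \sum_i a (rshift m i) *: v i.
Proof.
rewrite big_split_ord; congr (_ + _); apply: eq_bigr => i _; rewrite /fcat.
  by rewrite (unsplitK (inl i)).
by rewrite (unsplitK (inr i)).
Qed.

Lemma fcat_in Z m n (u : 'I_m -> V) (v : 'I_n -> V) :
  (forall i, Z (u i)) -> (forall i, Z (v i)) -> forall i, Z (fcat u v i).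
Proof. by move=> Zu Zv i; rewrite /fcat; case: fintype.split. Qed.

Lemma free_fcat B m n (u : 'I_m -> V) (v : 'I_n -> V) :
  (forall a b, B (\sum_i a i *: u i + \sum_i b i *: v i) ->
     (forall i, a i = 0) /\ (forall i, b i = 0)) ->
  free_mod B (fcat u v).
Proof.
move=> h a; rewrite sum_fcat => /h [h1 h2] i.
by case: (splitP i) => j ij; [rewrite -(h1 j)|rewrite -(h2 j)];
  congr a; apply: val_inj.
Qed.

Lemma fcat_free B m n (u : 'I_m -> V) (v : 'I_n -> V) a b :
  free_mod B (fcat u v) -> B (\sum_i a i *: u i + \sum_i b i *: v i) ->
  (forall i, a i = 0) /\ (forall i, b i = 0).
Proof.
move=> h Bab.
pose c (i : 'I_(m + n)) := match fintype.split i with inl j => a j | inr j => b j end.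
have cl i : c (lshift n i) = a i by rewrite /c (unsplitK (inl i)).
have cr i : c (rshift m i) = b i by rewrite /c (unsplitK (inr i)).
have /h c0 : B (\sum_i c i *: fcat u v i).
  rewrite sum_fcat.
  under eq_bigr do rewrite cl.
  by under [X in _ + X]eq_bigr do rewrite cr.
by split => i; rewrite -?cl -?cr.
Qed.

Definition spans_mod Z B n (u : 'I_n -> V) :=
  forall z, Z z -> exists a : 'I_n -> F, B (z - \sum_i a i *: u i).

(** The families that extend [u] freely have bounded length because of [~ dim_mod_ge Z B m]. One of
    maximal length spans, since a vector of [Z] outside its span could be appended. *)
Lemma free_mod_extend Z B n m (u : 'I_n -> V) :
  is_subspace B -> ~ dim_mod_ge Z B m ->
  (forall i, Z (u i)) -> free_mod B u ->
  exists p (v : 'I_p -> V),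
    [/\ forall i, Z (v i), free_mod B (fcat u v) & spans_mod Z B (fcat u v)].
Proof.
move=> sB nm Zu fu.
pose P p := exists v : 'I_p -> V, (forall i, Z (v i)) /\ free_mod B (fcat u v).
have exP : exists p, `[<P p>].
  exists 0%N; apply/asboolP; exists (fun=> 0); split; first by case.
  apply: free_fcat => a b; rewrite [X in _ + X]big_ord0 addr0 => /fu a0.
  by split=> // -[].
have dimle p k : dim_mod_ge Z B (p + k) -> dim_mod_ge Z B p.
  move=> [z [Zz fz]]; exists (fun i => z (lshift k i)); split=> // a Ba.
  have [||] := @fcat_free B p k (fun i => z (lshift k i))
    (fun i => z (rshift p i)) a (fun=> 0).
  - apply: free_fcat => a' b' h.
    pose c (i : 'I_(p + k)) :=
      match fintype.split i with inl j => a' j | inr j => b' j end.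
    have cl i : c (lshift k i) = a' i by rewrite /c (unsplitK (inl i)).
    have cr i : c (rshift p i) = b' i by rewrite /c (unsplitK (inr i)).
    have /fz c0 : B (\sum_i c i *: z i).
      rewrite big_split_ord /=.
      under eq_bigr do rewrite cl.
      by under [X in _ + X]eq_bigr do rewrite cr.
    by split => i; rewrite -?cl -?cr.
  - by rewrite [X in _ + X]big1 ?addr0 // => i _; rewrite scale0r.
  - by [].
have Pm p : `[<P p>] -> (p <= m)%N.
  move=> /asboolP [v [Zv fv]]; rewrite leqNgt; apply/negP => mp; apply: nm.
  have e : (m + (n + p - m) = n + p)%N by lia.
  apply: (dimle m (n + p - m)%N); rewrite e.
  by exists (fcat u v); split=> //; apply: fcat_in.
case: (ex_maxnP exP Pm) => p /asboolP[v [Zv fv]] maxp.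
exists p, v; split=> // z Zz; apply: contrapT => nz.
suff : (p.+1 <= p)%N by rewrite ltnn.
rewrite -addn1; apply: maxp; apply/asboolP.
exists (fcat v (fun _ : 'I_1 => z)); split; first exact: fcat_in.
apply: free_fcat => a b; rewrite sum_fcat big_ord1 addrA.
set c := b _ => h.
(* Otherwise dividing the relation by [c] would express [z] modulo [B] through the family, against
   [nz]. *)
have c0 : c = 0.
  apply: contrapT => /eqP c0; apply: nz.
  pose d (i : 'I_(n + p)) := match fintype.split i with
    inl j => - c^-1 * a j | inr j => - c^-1 * b (lshift 1 j) end.
  exists d; rewrite sum_fcat.
  have dl i : d (lshift p i) = - c^-1 * a i by rewrite /d (unsplitK (inl i)).
  have dr i : d (rshift n i) = - c^-1 * b (lshift 1 i)
    by rewrite /d (unsplitK (inr i)).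
  have -> : \sum_i d (lshift p i) *: u i = - c^-1 *: \sum_i a i *: u i.
    by rewrite scaler_sumr; apply: eq_bigr => i _; rewrite dl scalerA.
  have -> : \sum_i d (rshift n i) *: v i =
      - c^-1 *: \sum_i b (lshift 1 i) *: v i.
    by rewrite scaler_sumr; apply: eq_bigr => i _; rewrite dr scalerA.
  have := is_subspaceZ c^-1 sB h.
  rewrite scalerDr scalerA mulVf // scale1r scalerDr !scaleNr -opprD opprK.
  by rewrite addrC.
move: h; rewrite c0 scale0r addr0 => /(fcat_free fv) [a0 b0]; split=> // i.
case: (splitP i) => j ij; [rewrite -(b0 j)|rewrite -c0 /c];
  congr b; apply: val_inj; rewrite //= ij.
by case: j ij => -[].
Qed.

(** The coordinates modulo [B] of [n > k] vectors form an [n] by [k] matrix; its left kernel is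
    nonzero and gives a nontrivial relation between them. *)
Lemma spans_mod_bound Z B k n (u : 'I_k -> V) :
  is_subspace B -> spans_mod Z B u -> dim_mod_ge Z B n -> (n <= k)%N.
Proof.
move=> sB spu [z [Zz fz]]; rewrite leqNgt; apply/negP => kn.
have /choice [A hA] : forall i, exists a : 'I_k -> F,
    B (z i - \sum_j a j *: u j) by move=> i; apply: spu.
pose M : 'M[F]_(n, k) := \matrix_(i, j) A i j.
have /rowV0Pn [x xM x0] : kermx M != 0.
  rewrite -mxrank_eq0 mxrank_ker subn_eq0 -ltnNge.
  exact: leq_ltn_trans (rank_leq_col M) kn.
have {}xM : x *m M = 0 by apply/sub_kermxP.
have /fz x0' : B (\sum_i x 0 i *: z i).
  suff -> : \sum_i x 0 i *: z i =
      \sum_i x 0 i *: (z i - \sum_j A i j *: u j).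
    by apply: is_subspace_sum => // i; apply: is_subspaceZ.
  under [RHS]eq_bigr do rewrite scalerBr.
  rewrite sumrB; apply/esym/eqP; rewrite subr_eq addrC -subr_eq subrr eq_sym.
  under eq_bigr do rewrite scaler_sumr.
  rewrite exchange_big /= big1 // => j _.
  under eq_bigr do rewrite scalerA.
  rewrite -scaler_suml; have -> : \sum_i x 0 i * A i j = (x *m M) 0 j.
    by rewrite mxE; apply: eq_bigr => i _; rewrite mxE.
  by rewrite xM mxE scale0r.
by move/eqP: x0; apply; apply/rowP => i; rewrite x0' mxE.
Qed.

(** Written in the same way as [homology_rank], which unfolds to an instance of it. *)
Definition rk Z B : nat :=
  xget 0%N [set n | dim_mod_ge Z B n /\ ~ dim_mod_ge Z B n.+1].

Definition finite_mod Z B := exists n, ~ dim_mod_ge Z B n.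

Lemma dim_mod_geS Z B Z' B' n : Z `<=` Z' -> B' `<=` B ->
  dim_mod_ge Z B n -> dim_mod_ge Z' B' n.
Proof.
move=> ZZ BB [z [Zz fz]]; exists z; split=> [i|a /BB]; first exact: ZZ.
exact: fz.
Qed.

Lemma finite_modS Z B Z' B' : Z `<=` Z' -> B' `<=` B ->
  finite_mod Z' B' -> finite_mod Z B.
Proof. by move=> ZZ BB [n h]; exists n; apply: contra_not h; apply: dim_mod_geS. Qed.

Lemma rk_basis Z B n (u : 'I_n -> V) : is_subspace B ->
  (forall i, Z (u i)) -> free_mod B u -> spans_mod Z B u -> rk Z B = n.
Proof.
move=> sB Zu fu spu; rewrite /rk; apply: xget_unique.
  split; first by exists u.
  by move/(spans_mod_bound sB spu); rewrite ltnn.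
(* Uniqueness: if [m < n], the first [m.+1] vectors of the basis contradict [hm2]; a relation
   between them is completed by zeros. *)
move=> m [hm1 hm2]; have := spans_mod_bound sB spu hm1.
rewrite leq_eqVlt => /predU1P[//|mn]; exfalso; apply: hm2.
exists (fun i : 'I_m.+1 => u (widen_ord mn i)); split=> // a Ba i.
pose c (j : 'I_n) := if insub (val j) is Some i then a i else 0.
have ci i' : c (widen_ord mn i') = a i' by rewrite /c /= valK.
rewrite -ci; apply: fu.
suff -> : \sum_j c j *: u j = \sum_i0 a i0 *: u (widen_ord mn i0) by [].
rewrite (bigID (fun j : 'I_n => (j < m.+1)%N)) /= [X in _ + X]big1 ?addr0.
  by rewrite (big_ord_narrow mn); apply: eq_bigr => j _; rewrite ci.
by move=> j jm; rewrite /c insubN ?scale0r.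
Qed.

Lemma rk_exists_basis Z B : is_subspace B -> finite_mod Z B ->
  exists u : 'I_(rk Z B) -> V,
    [/\ forall i, Z (u i), free_mod B u & spans_mod Z B u].
Proof.
move=> sB [m hm].
have [||p [v [Zv fv spv]]] := @free_mod_extend Z B 0 m (fun=> 0) sB hm.
- by case.
- by move=> a _ [].
have Zc : forall i, Z (fcat (fun _ : 'I_0 => 0) v i) by apply: fcat_in => // -[].
have e := rk_basis sB Zc fv spv.
by rewrite e; exists (fcat (fun _ : 'I_0 => 0) v).
Qed.

Lemma rk_ge Z B n : is_subspace B -> finite_mod Z B -> dim_mod_ge Z B n ->
  (n <= rk Z B)%N.
Proof.
move=> sB fZ; have [u [_ _ spu]] := rk_exists_basis sB fZ.
exact: spans_mod_bound sB spu.
Qed.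

Lemma leq_rk Z B Z' B' : is_subspace B -> is_subspace B' ->
  Z `<=` Z' -> B' `<=` B -> finite_mod Z' B' -> (rk Z B <= rk Z' B')%N.
Proof.
move=> sB sB' ZZ BB fZ.
have [u [Zu fu _]] := rk_exists_basis sB (finite_modS ZZ BB fZ).
by apply: rk_ge => //; apply: (dim_mod_geS ZZ BB); exists u.
Qed.

(** Frobenius' inequality for Z1 -> Z2 -> V / B1 -> V / B2. A basis [u] of [Z1] modulo [B2] is
    completed by [v] to one of [Z2] modulo [B2], and by [w] to one of [Z1] modulo [B1]. Corrected by
    combinations of [u], the vectors [w] fall into [B2]. Then [u], [v] and the corrected [w] are
    free modulo [B1]: modulo [B2] a relation only involves [u] and [v], whose coefficients vanish,
    and what remains is a relation between [u] and [w] modulo [B1]. *)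
Lemma rk_frobenius Z1 Z2 B1 B2 : is_subspace Z1 -> is_subspace B1 -> is_subspace B2 ->
  Z1 `<=` Z2 -> B1 `<=` B2 -> finite_mod Z2 B1 ->
  (rk Z1 B1 + rk Z2 B2 <= rk Z2 B1 + rk Z1 B2)%N.
Proof.
move=> sZ1 sB1 sB2 Z12 B12 f21.
have [u [Zu fu spu]] := rk_exists_basis sB2 (finite_modS Z12 B12 f21).
have [n22 f22] : finite_mod Z2 B2 by apply: finite_modS f21.
have [n11 f11] : finite_mod Z1 B1 by apply: finite_modS f21.
have Zu2 i : Z2 (u i) by exact: Z12.
have [p [v [Zv fv spv]]] := free_mod_extend sB2 f22 Zu2 fu.
have fu1 : free_mod B1 u by move=> a /B12; apply: fu.
have [q [w [Zw fw spw]]] := free_mod_extend sB1 f11 Zu fu1.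
rewrite (rk_basis sB2 (fcat_in Zu2 Zv) fv spv).
rewrite (rk_basis sB1 (fcat_in Zu Zw) fw spw).
have /choice [A hA] : forall i, exists a : 'I_(rk Z1 B2) -> F,
  B2 (w i - \sum_j a j *: u j) by move=> i; apply: spu.
suff : ((rk Z1 B2 + p) + q <= rk Z2 B1)%N by lia.
apply: rk_ge => //.
exists (fcat (fcat u v) (fun i => w i - \sum_j A i j *: u j)); split.
  apply: fcat_in; first exact: fcat_in.
  move=> i; apply: Z12; apply: is_subspaceB => //.
  by apply: is_subspace_sum => // j; apply: is_subspaceZ.
apply: free_fcat => a b h.
have h2 : B2 (\sum_i a i *: fcat u v i).
  rewrite -[X in B2 X](addrK (\sum_i b i *: (w i - \sum_j A i j *: u j))).
  apply: is_subspaceB => //; first exact: B12.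
  by apply: is_subspace_sum => // i; apply: is_subspaceZ.
have a0 := fv _ h2; split=> //.
move: h; rewrite big1 ?add0r => [|i _]; last by rewrite a0 scale0r.
have -> : \sum_i b i *: (w i - \sum_j A i j *: u j) =
  \sum_j (- \sum_i b i * A i j) *: u j + \sum_i b i *: w i.
  under eq_bigr do rewrite scalerBr.
  rewrite sumrB addrC; congr (_ + _).
  under [RHS]eq_bigr do rewrite scaleNr scaler_suml.
  rewrite sumrN exchange_big /=; congr (- _); apply: eq_bigr => i _.
  by rewrite scaler_sumr; apply: eq_bigr => j _; rewrite scalerA.
by case/(fcat_free fw).
Qed.

(** The last two hypotheses are the surjectivity and the injectivity of the map induced by
    inclusion, from the image of [Z'] in V / B' to the image of [Z] in V / B. *)
Lemma dim_mod_ge_retract Z B Z' B' n :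
  is_subspace B -> is_subspace Z' -> Z' `<=` Z -> B' `<=` B ->
  (forall z, Z z -> exists2 z', Z' z' & B (z - z')) ->
  (forall z, Z' z -> B z -> B' z) ->
  dim_mod_ge Z B n <-> dim_mod_ge Z' B' n.
Proof.
move=> sB sZ' ZZ BB hZ hB; split=> -[z [Zz fz]].
  have /choice [z' hz'] : forall i, exists z', Z' z' /\ B (z i - z').
    by move=> i; have [z' ? ?] := hZ _ (Zz i); exists z'.
  exists z'; split=> [i|a /BB Ba]; first by case: (hz' i).
  apply: fz; rewrite -[X in B X](subrK (\sum_i a i *: z' i)).
  apply: is_subspaceD => //; rewrite -sumrB; apply: is_subspace_sum => // i.
  by rewrite -scalerBr; apply: is_subspaceZ => //; case: (hz' i).
exists z; split=> [i|a Ba]; first exact: ZZ.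
apply: fz; apply: hB Ba; apply: is_subspace_sum => // i.
exact: is_subspaceZ.
Qed.

End Rank.

(** A relation between the vectors [f (z i)] modulo [B'] is carried back by [g], which recovers the
    [z i]. *)
Lemma dim_mod_ge_section (F : fieldType) (V W : lmodType F)
    (Z B : set V) (Z' B' : set W) (f : V -> W) (g : W -> V) n :
  (forall n (a : 'I_n -> F) z, g (\sum_i a i *: z i) = \sum_i a i *: g (z i)) ->
  (forall z, Z z -> Z' (f z)) -> (forall z, B' z -> B (g z)) ->
  (forall z, Z z -> g (f z) = z) ->
  dim_mod_ge Z B n -> dim_mod_ge Z' B' n.
Proof.
move=> glin fZ gB gf [z [Zz fz]]; exists (f \o z); split=> [i|a /gB].
  exact: fZ.
rewrite glin => Ba; apply: fz; congr B: Ba; apply: eq_bigr => i _.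
by rewrite /= gf.
Qed.

(** * Chains and their boundaries *)

(** Sets one position apart: [r] is what [s] induces on the others, and [odd_lift_perm] then relates
    the signs of [s] and [r]. *)
Lemma perm_lift_perm n (s : 'S_n.+1) i :
  exists r : 'S_n, s = lift_perm i (s i) r.
Proof.
have /choice [f hf] : forall j, exists k, s (lift i j) = lift (s i) k.
  move=> j; case: (unliftP (s i) (s (lift i j))) => [k ->|/perm_inj /eqP].
    by exists k.
  by rewrite eq_sym (negbTE (neq_lift i j)).
have fi : injective f.
  by move=> j j' e; apply: (@lift_inj _ i); apply: (@perm_inj _ s); rewrite !hf e.
exists (perm fi); apply/permP => k; case: (unliftP i k) => [j ->|->].
  by rewrite lift_perm_lift permE hf.
by rewrite lift_perm_id.
Qed.

Section Tuples.
Variable T : choiceType.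

Definition tact n (s : 'S_n) (x : n.-tuple T) : n.-tuple T :=
  [tuple tnth x (s i) | i < n].

Definition del n (i : 'I_n.+1) (x : n.+1.-tuple T) : n.-tuple T :=
  [tuple tnth x (lift i j) | j < n].

Lemma mem_tact n (s : 'S_n) (x : n.-tuple T) : tact s x =i x.
Proof.
move=> v; apply/tnthP/tnthP => -[i ->].
  by exists (s i); rewrite tnth_mktuple.
by exists (s^-1%g i); rewrite tnth_mktuple permKV.
Qed.

Lemma uniq_tact n (s : 'S_n) (x : n.-tuple T) : uniq (tact s x) = uniq x.
Proof.
apply/tuple_uniqP/tuple_uniqP => inj i j.
  move=> e; apply: (@perm_inj _ s^-1%g); apply: inj.
  by rewrite !tnth_mktuple !permKV.
by rewrite !tnth_mktuple => /inj /perm_inj.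
Qed.

Lemma tact_lift_perm n (i j : 'I_n.+1) (r : 'S_n) (x : n.+1.-tuple T) :
  del i (tact (lift_perm i j r) x) = tact r (del j x).
Proof.
by apply: eq_from_tnth => k; rewrite !tnth_mktuple lift_perm_lift.
Qed.

Lemma cons_del0 n (x : n.+1.-tuple T) :
  x = [tuple of tnth x ord0 :: del ord0 x].
Proof.
apply: eq_from_tnth => i; case: (unliftP ord0 i) => [j ->|->].
  by rewrite tnthS tnth_mktuple.
by rewrite tnth0.
Qed.

Lemma del_cons0 n v (x : n.-tuple T) : del ord0 [tuple of v :: x] = x.
Proof. by apply: eq_from_tnth => i; rewrite tnth_mktuple tnthS. Qed.

Lemma del_cons n v (x : n.+1.-tuple T) j :
  del (lift ord0 j) [tuple of v :: x] = [tuple of v :: del j x].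
Proof.
apply: eq_from_tnth => i; rewrite tnth_mktuple.
case: (unliftP ord0 i) => [k ->|->].
  have -> : lift (lift ord0 j) (lift ord0 k) = lift ord0 (lift j k).
    by apply: val_inj; rewrite /= /bump /= !add1n ltnS addnS.
  by rewrite !tnthS tnth_mktuple.
have -> : lift (lift ord0 j) ord0 = ord0 :> 'I_n.+2 by apply: val_inj.
by rewrite !tnth0.
Qed.

Lemma mem_del n (x : n.+1.-tuple T) i v :
  v \in x -> v != tnth x i -> v \in del i x.
Proof.
move=> /tnthP[j ->]; case: (unliftP i j) => [k -> _|->]; last by rewrite eqxx.
by apply/tnthP; exists k; rewrite tnth_mktuple.
Qed.

Lemma del_sub n (x : n.+1.-tuple T) i : {subset del i x <= x}.
Proof.
by move=> v /tnthP[j ->]; rewrite tnth_mktuple mem_tnth.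
Qed.

Lemma mem_tnth_del n (x : n.+1.-tuple T) i v :
  v \in x -> v = tnth x i \/ v \in del i x.
Proof.
by have [->|/[swap]/mem_del/[apply]] := eqVneq v (tnth x i); [left|right].
Qed.

Lemma finite_tuples n (W : {fset T}) :
  finite_set [set x : n.-tuple T | {subset x <= W}].
Proof.
have [f hf] : exists f : n.-tuple W -> n.-tuple T,
    forall x, {subset x <= W} -> exists y, f y = x.
  exists (fun y => [tuple val (tnth y i) | i < n]) => x xW.
  have xiW i : tnth x i \in W by apply: xW; apply: mem_tnth.
  exists [tuple [` xiW i]%fset | i < n].
  by apply: eq_from_tnth => i; rewrite !tnth_mktuple.
apply: (@sub_finite_set _ _ (f @` setT)); first by move=> x /hf[y]; exists y.
by apply: finite_image; apply: finite_finset.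
Qed.

End Tuples.

Section Chains.
Variables (F : fieldType) (T : choiceType).
Implicit Types (K L : set {fset T}) (A : set T).

Definition alternating_fun n (c : n.-tuple T -> F^o) :=
  forall (s : 'S_n) x, c (tact s x) = (-1) ^+ s * c x.

(** Finite support is handled through a finite set [W] of vertices: it turns the sum over all of [T]
    in the boundary into a finite sum, over a range independent of the tuple. *)
Definition vertices_in n (c : n.-tuple T -> F^o) (W : {fset T}) :=
  forall x, c x != 0 -> {subset x <= W}.

Lemma finite_vertices n (c : n.-tuple T -> F^o) :
  finite_set [set x | c x != 0] <-> exists W, vertices_in c W.
Proof.
split=> [/finite_fsetP[X hX]|[W hW]]; last first.
  by apply: sub_finite_set (finite_tuples n W) => x; apply: hW.
exists (\bigcup_(x <- X) [fset v in tval x])%fset => x cx v vx.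
apply/bigfcupP; exists x; last by rewrite inE.
by rewrite andbT; have : [set` X] x by rewrite -hX.
Qed.

Lemma chainsP K k (c : k.+1.-tuple T -> F^o) : @chains F T K k c <->
  [/\ exists W, vertices_in c W,
      forall x, c x != 0 -> uniq x /\ K [fset v in tval x]%fset &
      alternating_fun c].
Proof. by split=> -[/finite_vertices]. Qed.

(** The formula of [boundary], extended to 0-chains, where it is the augmentation evaluated at the
    empty tuple. This lets degree 0 be treated together with the others. *)
Definition bd n (c : n.+1.-tuple T -> F^o) : n.-tuple T -> F^o :=
  fun x => \sum_(v \in [set: T]) c [tuple of v :: x].

Lemma bdE n (c : n.+1.-tuple T -> F^o) (W : {fset T}) x : vertices_in c W ->
  bd c x = \sum_(v <- W) c [tuple of v :: x].
Proof.
move=> cW; apply: fsbigTE => v vW; apply: contraNeq vW => /cW; apply.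
by rewrite inE eqxx.
Qed.

Lemma vertices_inS n (c : n.-tuple T -> F^o) (W W' : {fset T}) :
  {subset W <= W'} -> vertices_in c W -> vertices_in c W'.
Proof. by move=> WW cW x /cW xW v /xW /WW. Qed.

Lemma bd_neq0 n (c : n.+1.-tuple T -> F^o) (x : n.-tuple T) :
  bd c x != 0 -> exists v, c [tuple of v :: x] != 0.
Proof.
apply: contra_neqP => /forallNP h; apply: fsbig1 => v _.
by apply/eqP/negPn/negP; apply: h.
Qed.

Lemma vertices_in_bd n (c : n.+1.-tuple T -> F^o) (W : {fset T}) :
  vertices_in c W -> vertices_in (bd c) W.
Proof.
by move=> cW x /bd_neq0 [v /cW vxW] w wx; apply: vxW; rewrite inE wx orbT.
Qed.

Lemma vertices_in_lin n a (c d : n.-tuple T -> F^o) (W W' : {fset T}) :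
  vertices_in c W -> vertices_in d W' ->
  vertices_in (a *: c + d) (W `|` W')%fset.
Proof.
move=> cW dW x.
have [c0|/cW xW _ v /xW vW] := eqVneq (c x) 0; last by rewrite inE vW.
have [d0|/dW xW _ v /xW vW] := eqVneq (d x) 0; last by rewrite inE vW orbT.
suff -> : (a *: c + d) x = a *: c x + d x by rewrite c0 d0 scaler0 addr0 eqxx.
by [].
Qed.

Lemma bd_lin n a (c d : n.+1.-tuple T -> F^o) (W W' : {fset T}) :
  vertices_in c W -> vertices_in d W' -> bd (a *: c + d) = a *: bd c + bd d.
Proof.
move=> cW dW; apply/funext => x.
have WU : {subset W <= W `|` W'}%fset by move=> v vW; rewrite inE vW.
have WU' : {subset W' <= W `|` W'}%fset by move=> v vW; rewrite inE vW orbT.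
rewrite (bdE x (vertices_in_lin cW dW)) /=.
have -> : (a *: bd c + bd d) x = a *: bd c x + bd d x by [].
rewrite (bdE x (vertices_inS WU cW)) (bdE x (vertices_inS WU' dW)).
by rewrite scaler_sumr -big_split.
Qed.

Lemma alternating_swap n (c : n.+2.-tuple T -> F^o) v w (x : n.-tuple T) :
  alternating_fun c -> c [tuple of v :: w :: x] = - c [tuple of w :: v :: x].
Proof.
move=> altc; pose t : 'S_n.+2 := tperm ord0 (lift ord0 ord0).
have -> : [tuple of v :: w :: x] = tact t [tuple of w :: v :: x].
  apply: eq_from_tnth => i; rewrite tnth_mktuple /t.
  case: (unliftP ord0 i) => [j ->|->]; last first.
    by rewrite tpermL tnth0 tnthS tnth0.
  case: (unliftP ord0 j) => [k ->|->]; last first.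
    by rewrite tpermR tnth0 tnthS tnth0.
  by rewrite tpermD ?tnthS // -?val_eqE.
by rewrite altc odd_tperm -val_eqE /= expr1 mulN1r.
Qed.

(** In characteristic 2 antisymmetry does not make the diagonal vanish, whence the separate
    hypothesis on [g v v]; for chains it comes from the absence of repeated vertices. *)
Lemma double_sum_alt (g : T -> T -> F) (s : seq T) :
  (forall v, g v v = 0) -> (forall v w, g v w = - g w v) ->
  \sum_(v <- s) \sum_(w <- s) g v w = 0.
Proof.
move=> g0 ga; elim: s => [|a s IH]; first by rewrite !big_nil.
rewrite big_cons big_cons g0 add0r.
under [X in _ + X]eq_bigr do rewrite big_cons.
rewrite big_split /= IH addr0 -big_split /= big1 // => v _.
by rewrite [g v a]ga subrr.
Qed.

Lemma bd_bd n (c : n.+2.-tuple T -> F^o) (W : {fset T}) : vertices_in c W ->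
  (forall x, c x != 0 -> uniq x) -> alternating_fun c -> bd (bd c) = 0.
Proof.
move=> cW cu altc; apply/funext => x.
rewrite (bdE x (vertices_in_bd cW)).
under eq_bigr do rewrite (bdE _ cW).
apply: double_sum_alt => [v|v w]; last exact: alternating_swap.
apply/eqP; apply: contraT => /cu /=.
by rewrite inE eqxx.
Qed.

Lemma alternating_bd n (c : n.+1.-tuple T -> F^o) :
  alternating_fun c -> alternating_fun (bd c).
Proof.
move=> altc s x.
have cE v : c [tuple of v :: tact s x] = (-1) ^+ s * c [tuple of v :: x].
  have := altc (lift_perm ord0 ord0 s) [tuple of v :: x].
  rewrite odd_lift_perm /= => <-; congr c.
  rewrite [RHS]cons_del0 tact_lift_perm del_cons0 tnth_mktuple lift_perm_id.
  by rewrite tnth0.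
rewrite /bd mulr_fsumr; apply: eq_fsbigr => v _; exact: cE.
Qed.

Definition complex K :=
  forall (s t : {fset T}), K s -> t != fset0 -> (t `<=` s)%fset -> K t.

Lemma chains_bd K k (c : k.+2.-tuple T -> F^o) : complex K ->
  @chains F T K k.+1 c -> @chains F T K k (bd c).
Proof.
move=> sK /chainsP[[W cW] cK ca]; apply/chainsP; split.
- by exists W; apply: vertices_in_bd.
- move=> x /bd_neq0[v /cK[/= /andP[_ ux] Kx]]; split=> //.
  apply: (sK _ _ Kx).
    apply/fset0Pn; exists (tnth x ord0); rewrite inE; exact: mem_tnth.
  by apply/fsubsetP => w; rewrite !inE => ->; rewrite orbT.
- exact: alternating_bd.
Qed.

Lemma subspace_chains K k : is_subspace (@chains F T K k).
Proof.
split.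
  apply/chainsP; split=> [|x|s x].
  - by exists fset0 => x; rewrite eqxx.
  - by rewrite eqxx.
  - by rewrite [RHS]mulr0.
move=> a c d /chainsP[[W cW] cK ca] /chainsP[[W' dW] dK da].
apply/chainsP; split=> [|x|s x].
- by exists (W `|` W')%fset; apply: vertices_in_lin.
- have -> : (a *: c + d) x = a *: c x + d x by [].
  have [c0|/cK //] := eqVneq (c x) 0.
  have [d0|/dK //] := eqVneq (d x) 0.
  by rewrite c0 d0 scaler0 addr0 eqxx.
- have E y : (a *: c + d) y = a * c y + d y by [].
  by rewrite E [in RHS]E ca da mulrDr mulrCA.
Qed.

Lemma boundary_lin K k a (c d : k.+2.-tuple T -> F^o) :
  @chains F T K k.+1 c -> @chains F T K k.+1 d ->
  boundary (a *: c + d) = a *: boundary c + boundary d.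
Proof.
by move=> /chainsP[[W cW] _ _] /chainsP[[W' dW] _ _]; apply: bd_lin cW dW.
Qed.

Lemma boundary0 k : boundary (0 : k.+2.-tuple T -> F^o) = 0.
Proof. by apply/funext => x; apply: fsbig1. Qed.

Lemma subspace_cycles K k : is_subspace (@cycles F T K k).
Proof.
case: k => [|k]; first exact: subspace_chains.
have [h0 h] := subspace_chains K k.+1; split; first by split=> //; apply: boundary0.
move=> a c d [cK bc] [dK bd0]; split; first exact: h.
by rewrite (boundary_lin a cK dK) bc bd0; apply/funext => x; rewrite [LHS]addr0 [LHS]mulr0.
Qed.

Lemma subspace_boundaries K k : is_subspace (@boundaries F T K k).
Proof.
have [h0 h] := subspace_chains K k.+1; split.
  by exists 0 => //; apply: boundary0.
move=> a _ _ [c cK <-] [d dK <-]; exists (a *: c + d); first exact: h.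
exact: (boundary_lin a cK dK).
Qed.

Lemma chainsS K L k : K `<=` L -> @chains F T K k `<=` @chains F T L k.
Proof.
by move=> KL c [cf cK ca]; split=> // x /cK [ux /KL].
Qed.

Lemma cyclesS K L k : K `<=` L -> @cycles F T K k `<=` @cycles F T L k.
Proof.
move=> KL; case: k => [|k]; first exact: chainsS.
by move=> c [/(chainsS KL)].
Qed.

Lemma boundariesS K L k : K `<=` L -> @boundaries F T K k `<=` @boundaries F T L k.
Proof. by move=> KL _ [c /(chainsS KL) cL <-]; exists c. Qed.

End Chains.

(** * Merging vertices *)

Section Move.
Variables (F : fieldType) (T : choiceType).
Implicit Types (K L : set {fset T}) (A : set T).

(* The exterior product of the vertex [w] with [c]. *)
Definition wedge n (w : T) (c : n.-tuple T -> F^o) : n.+1.-tuple T -> F^o :=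
  fun x => if uniq x then
    \sum_i (tnth x i == w)%:R * ((-1) ^+ i * c (del i x)) else 0.

Lemma wedgeE n w (c : n.-tuple T -> F^o) (x : n.+1.-tuple T) i :
  uniq x -> tnth x i = w -> wedge w c x = (-1) ^+ i * c (del i x).
Proof.
move=> ux xi; rewrite /wedge ux (bigD1 i) //= xi eqxx mul1r big1 ?addr0 //.
move=> j ji; rewrite -xi; case: eqP => [/(tuple_uniqP _ ux) e|_].
  by rewrite e eqxx in ji.
by rewrite mul0r.
Qed.

Lemma wedge_notin n w (c : n.-tuple T -> F^o) (x : n.+1.-tuple T) :
  w \notin x -> wedge w c x = 0.
Proof.
move=> wx; rewrite /wedge; case: ifP => // _; rewrite big1 // => i _.
case: eqP => [e|_]; last by rewrite mul0r.
by rewrite -e mem_tnth in wx.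
Qed.

Lemma wedge_neq0 n w (c : n.-tuple T -> F^o) (x : n.+1.-tuple T) :
  wedge w c x != 0 ->
  uniq x /\ exists i, tnth x i = w /\ c (del i x) != 0.
Proof.
move=> h; have ux : uniq x by move: h; rewrite /wedge; case: uniq => //; rewrite eqxx.
split=> //; have [/tnthP[i e]|/wedge_notin wx] := boolP (w \in x).
  exists i; split=> //; apply: contraNneq h => c0.
  by rewrite (wedgeE _ ux (esym e)) c0 mulr0.
by rewrite wx eqxx in h.
Qed.

Lemma alternating_wedge n w (c : n.-tuple T -> F^o) :
  alternating_fun c -> alternating_fun (wedge w c).
Proof.
move=> ca s x; have [ux|ux] := boolP (uniq x); last first.
  by rewrite /wedge uniq_tact (negbTE ux) mulr0.
have [/tnthP[j e]|wx] := boolP (w \in x); last first.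
  by rewrite !wedge_notin ?mulr0 // mem_tact.
have usx : uniq (tact s x) by rewrite uniq_tact.
have sj : tnth (tact s x) (s^-1%g j) = w by rewrite tnth_mktuple permKV.
rewrite (wedgeE _ usx sj) (wedgeE _ ux (esym e)).
have [r hr] := perm_lift_perm s (s^-1%g j); rewrite permKV in hr.
have -> : del (s^-1%g j) (tact s x) = tact r (del j x).
  by rewrite -(tact_lift_perm (s^-1%g j)) -hr.
rewrite ca.
(* The sign of [s] is the sign of [r] times those of the positions of [w] before and after the
   permutation; the latter two are absorbed by the signs in [wedge]. *)
have -> : (-1) ^+ s = (-1) ^+ (s^-1%g j) * (-1) ^+ j * (-1) ^+ r :> F.
  have -> : odd_perm s = odd (s^-1%g j) (+) odd j (+) r.
    by rewrite -odd_lift_perm -hr.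
  by rewrite !signr_addb !signr_odd.
rewrite !mulrA; congr (_ * _).
by rewrite -!mulrA [(-1) ^+ r * _]mulrC [(-1) ^+ j * (_ * _)]mulrA -expr2 sqrr_sign mul1r.
Qed.

Variables (u u' : T).
Hypothesis uu' : u != u'.

(* Homotopy between the identity and the vertex map sending [u] to [u']: [bd
   (slide c)] cancels the part of [c] that contains [u]. *)
Definition slide n (c : n.-tuple T -> F^o) : n.+1.-tuple T -> F^o :=
  wedge u' (fun x => if u \in x then c x else 0).

(** If [u'] is not in [x], only the term [v = u'] survives, and it is [c x]. If [u'] is the entry
    [j] of [x], let [y] be [del j x]: the terms are those of [- (-1) ^+ j * bd c y] except the one
    at [u']. As [u] is in [y], the full sum is 0, so they add up to the opposite of the missing
    term, which is [c x]. *)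
Lemma bd_slide n (c : n.+1.-tuple T -> F^o) (W : {fset T}) x :
  vertices_in c W -> alternating_fun c -> (forall x, c x != 0 -> uniq x) ->
  (forall y : n.-tuple T, u \in y -> bd c y = 0) ->
  u \in x -> bd (slide c) x = c x.
Proof.
move=> cW ca cu cb ux.
have [qx|nqx] := boolP (uniq x); last first.
  transitivity (0 : F).
    apply: fsbig1 => v _; rewrite /slide /wedge /=.
    by rewrite (negbTE nqx) andbF.
  by apply/esym/eqP; apply: contraNT nqx => /cu.
set d := fun x : n.+1.-tuple T => if u \in x then c x else 0.
have [/tnthP[j e]|u'x] := boolP (u' \in x); last first.
  rewrite /bd (fsbigTE [fset u']%fset) => [|v].
    rewrite big_seq_fset1 /slide -/d.
    have qux : uniq [tuple of u' :: x] by rewrite /= u'x.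
    rewrite (wedgeE _ qux (tnth0 _ _)) expr0 mul1r del_cons0.
    by rewrite /d ux.
  rewrite inE => vu'; apply: wedge_notin; rewrite /= inE negb_or u'x.
  by rewrite eq_sym vu'.
have uy : u \in del j x by apply: mem_del => //; rewrite -e.
have E v : v != u' ->
    slide c [tuple of v :: x] = - ((-1) ^+ j * c [tuple of v :: del j x]).
  move=> vu'; have [vx|vx] := boolP (v \in x).
    rewrite /slide /wedge /= vx /=.
    have vy : v \in del j x by apply: mem_del => //; rewrite -e.
    suff -> : c [tuple of v :: del j x] = 0 by rewrite mulr0 oppr0.
    by apply/eqP; apply: contraT => /cu; rewrite /= vy.
  have qvx : uniq [tuple of v :: x] by rewrite /= vx.
  have vj : tnth [tuple of v :: x] (lift ord0 j) = u' by rewrite tnthS.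
  rewrite /slide (wedgeE _ qvx vj) del_cons inE uy orbT.
  by rewrite lift0 exprS mulN1r mulNr.
have E' : slide c [tuple of u' :: x] = 0.
  by rewrite /slide /wedge /= {1}e mem_tnth.
have /(congr1 (fun t => - (-1) ^+ j * t)) := cb _ uy.
rewrite /bd mulr_fsumr mulr0 => S0.
rewrite (fsbigTE (u' |` W)%fset) => [|v vW]; last first.
  have [vu'|vu'] := eqVneq v u'; first by rewrite vu' E'.
  rewrite E //; suff -> : c [tuple of v :: del j x] = 0 by rewrite mulr0 oppr0.
  apply: contraNeq vW => /cW /(_ v); rewrite !inE eqxx (negbTE vu') /=; exact.
rewrite (fsbigTE (u' |` W)%fset) in S0; last first.
  move=> v vW; suff -> : c [tuple of v :: del j x] = 0 by rewrite mulr0.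
  apply: contraNeq vW => /cW /(_ v); rewrite !inE eqxx /= => ->//.
  by rewrite orbT.
have u'W : u' \in (u' |` W)%fset by rewrite !inE eqxx.
rewrite (big_fsetD1 _ u'W) /= E' add0r.
rewrite (big_fsetD1 _ u'W) /= in S0.
transitivity (\sum_(v <- ((u' |` W) `\ u')%fset)
    - (-1) ^+ j * c [tuple of v :: del j x]).
  apply: eq_big_seq => v; rewrite !inE => /andP[vu' _].
  by rewrite E // mulNr.
move/eqP: S0; rewrite addrC addr_eq0 => /eqP ->.
rewrite mulNr opprK.
(* The cyclic permutation that brings entry [j] to the front has sign [(-1) ^+ j]. *)
have := ca (lift_perm ord0 j 1) x; rewrite odd_lift_perm odd_perm1 addbF /=.
rewrite signr_odd => cj.
have -> : [tuple of u' :: del j x] = tact (lift_perm ord0 j 1) x.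
  rewrite [RHS]cons_del0 tact_lift_perm tnth_mktuple lift_perm_id -e.
  by congr [tuple of _ :: _]; apply: eq_from_tnth => i; rewrite !tnth_mktuple perm1.
by rewrite cj mulrA -expr2 sqrr_sign mul1r.
Qed.

(** The hypothesis on [K] is contiguity of the identity and the vertex map sending [u] to [u'],
    which keeps the homotopy between them inside [K]. *)
Lemma chains_slide K k (c : k.+1.-tuple T -> F^o) :
  (forall s, K s -> u \in s -> K (u' |` s)%fset) ->
  @chains F T K k c -> @chains F T K k.+1 (slide c).
Proof.
move=> Ku /chainsP[[W cW] cK ca]; apply/chainsP; split.
- exists (u' |` W)%fset => x /wedge_neq0[_ [i [xi]]].
  case: ifP => [_ /cW yW v vx|]; last by rewrite eqxx.
  by rewrite !inE; have [->|/yW ->] := mem_tnth_del i vx;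
    rewrite ?xi ?eqxx ?orbT.
- move=> x /wedge_neq0[qx [i [xi]]].
  case: ifP => [uy /cK[_ Ky]|]; last by rewrite eqxx.
  split=> //; suff -> : [fset v in tval x]%fset =
      (u' |` [fset v in tval (del i x)])%fset by apply: Ku => //; rewrite inE.
  apply/fsetP => v; rewrite !inE; apply/idP/orP => [vx|[/eqP ->|]].
  + by have [->|->] := mem_tnth_del i vx; [left; rewrite xi|right].
  + by rewrite -xi mem_tnth.
  + exact: del_sub.
- apply: alternating_wedge => s x; rewrite mem_tact; case: ifP => _ //.
  by rewrite mulr0.
Qed.

End Move.

(** * Retraction onto a full subcomplex *)

Section Retract.
Variables (F : fieldType) (T : choiceType).
Implicit Types (K L : set {fset T}) (A : set T).

Definition full_subcomplex K A : set {fset T} := [set s | K s /\ [set` s] `<=` A].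

Lemma complex_full_subcomplex K A : complex K -> complex (full_subcomplex K A).
Proof.
move=> cK s t [Ks sA] t0 ts; split; first exact: cK ts.
by move=> v /(fsubsetP ts) /sA.
Qed.

Variables (A : set T) (p : T -> T).
Hypothesis pA : forall v, A (p v).

(** The list [l] holds the vertices still to be removed. Sliding [u] to [p u] kills the part of [c]
    that contains [u] and brings in no vertex but [p u], which is in [A]. The condition on [bd c]
    makes [c] a cycle relative to [A]; it gives what [bd_slide] requires, since a tuple containing
    [u] is not contained in [A], and it survives the subtraction of a boundary. *)
Lemma retract_chain_seq K k (l : seq T) (c : k.+1.-tuple T -> F^o) :
  complex K -> (forall s v, K s -> v \in s -> K (p v |` s)%fset) ->
  @chains F T (full_subcomplex K [set v | A v \/ v \in l]) k c ->
  (forall y : k.-tuple T, ~ [set` y] `<=` A -> bd c y = 0) ->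
  exists2 e, @chains F T K k.+1 e & @chains F T (full_subcomplex K A) k (c - bd e).
Proof.
move=> sK Kp; elim: l c => [|u l IH] c cc cb.
  exists 0; first by case: (subspace_chains F K k.+1).
  have -> : c - bd (0 : k.+2.-tuple T -> F^o) = c.
    by rewrite [bd 0]boundary0 subr0.
  by apply: chainsS cc => s [Ks sA]; split=> // v /sA[].
have [uA|nuA] := pselect (A u).
  apply: IH cb; apply: chainsS cc => s [Ks sA]; split=> // v /sA [|]; first by left.
  by rewrite inE => /predU1P[->|vl]; [left|right].
have uu' : u != p u by apply: contra_notN nuA => /eqP ->.
set B := [set v | A v \/ v \in u :: l] in cc.
have cc' := cc; case/chainsP : cc' => -[W cW] cK ca.
have cu x : c x != 0 -> uniq x by case/cK.
have cbu (y : k.-tuple T) : u \in y -> bd c y = 0.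
  by move=> uy; apply: cb => /(_ u uy).
have ec : @chains F T (full_subcomplex K B) k.+1 (slide u (p u) c).
  apply: chains_slide => // s [Ks sB] us; split; first exact: Kp.
  by move=> v /=; rewrite !inE => /orP[/eqP ->|/sB //]; left.
set e := slide u (p u) c in ec.
have dc : @chains F T (full_subcomplex K B) k (c - bd e).
  apply: is_subspaceB => //; first exact: subspace_chains.
  by apply: chains_bd ec; apply: complex_full_subcomplex.
have [W' eW'] : exists W', vertices_in e W' by case/chainsP: ec.
have du x : u \in x -> (c - bd e) x = 0.
  move=> ux; have -> : (c - bd e) x = c x - bd e x by [].
  by rewrite (bd_slide uu' cW ca cu cbu ux) subrr.
have [||e' e'K e'A] := IH (c - bd e).
- case/chainsP : dc => dW dK da; apply/chainsP; split=> // x dx.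
  have [qx [Kx xB]] := dK x dx; split=> //; split=> // v vx.
  have /= [?|/predU1P[vu|vl]] := xB v vx; [by left| |by right].
  have ux : u \in x by rewrite -vu; move: vx; rewrite /= inE.
  by move: dx; rewrite du ?eqxx.
- move=> y yA; rewrite addrC -scaleN1r (bd_lin _ (vertices_in_bd eW') cW).
  case/chainsP: ec => _ eK ea.
  rewrite (bd_bd eW') ?scaler0 ?add0r ?cb // => x /eK[].
  by [].
exists (e + e').
  apply: is_subspaceD => //; first exact: subspace_chains.
  by apply: chainsS ec => s [].
have -> : bd (e + e') = bd e + bd e'.
  have [W'' eW''] : exists W', vertices_in e' W' by case/chainsP: e'K.
  by rewrite -[e]scale1r (bd_lin 1 eW' eW'') !scale1r.
by rewrite opprD addrA.
Qed.

Lemma retract_chain K k (c : k.+1.-tuple T -> F^o) :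
  complex K -> (forall s v, K s -> v \in s -> K (p v |` s)%fset) ->
  @chains F T K k c ->
  (forall y : k.-tuple T, ~ [set` y] `<=` A -> bd c y = 0) ->
  exists2 e, @chains F T K k.+1 e & @chains F T (full_subcomplex K A) k (c - bd e).
Proof.
move=> sK Kp /chainsP[[W cW] cK ca] cb.
apply: (@retract_chain_seq K k W) => //; apply/chainsP; split=> //.
  by exists W.
move=> x cx; have [qx Kx] := cK x cx; split=> //; split=> // v /=.
by rewrite inE => vx; right; apply: cW vx.
Qed.

Lemma bd_bd_chains K k (e : k.+2.-tuple T -> F^o) :
  @chains F T K k.+1 e -> bd (bd e) = 0.
Proof.
by case/chainsP=> -[W eW] eK ea; apply: bd_bd eW _ ea => x /eK[].
Qed.

Lemma cycle_bd K k (c : k.+1.-tuple T -> F^o) y :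
  @cycles F T K k c -> (0 < k)%N -> bd c y = 0.
Proof. by case: k c y => // k c y [_ bc] _; rewrite [bd c]bc. Qed.

Lemma cycles_chains K k : @cycles F T K k `<=` @chains F T K k.
Proof. by case: k => // k c []. Qed.

Lemma bd_sub_bd K k (c : k.+1.-tuple T -> F^o) (e : k.+2.-tuple T -> F^o) :
  @chains F T K k c -> @chains F T K k.+1 e -> bd (c - bd e) = bd c.
Proof.
move=> /chainsP[[W cW] _ _] eK.
have [W' eW'] : exists W', vertices_in e W' by case/chainsP: eK.
rewrite addrC -scaleN1r (bd_lin _ (vertices_in_bd eW') cW).
by rewrite (bd_bd_chains eK) scaler0 add0r.
Qed.

Lemma dim_mod_ge_full_subcomplex K L k n : complex K -> complex L -> K `<=` L ->
  (forall s v, K s -> v \in s -> K (p v |` s)%fset) ->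
  (forall s v, L s -> v \in s -> L (p v |` s)%fset) ->
  dim_mod_ge (@cycles F T K k) (@boundaries F T L k) n <->
  dim_mod_ge (@cycles F T (full_subcomplex K A) k) (@boundaries F T (full_subcomplex L A) k) n.
Proof.
move=> cK cL KL Kp Lp.
have sub M : full_subcomplex M A `<=` M by move=> s [].
apply: dim_mod_ge_retract.
- exact: subspace_boundaries.
- exact: subspace_cycles.
- exact: cyclesS.
- exact: boundariesS.
- move=> z zZ; have zK := cycles_chains zZ.
  have [|e eK eA] := retract_chain cK Kp zK.
    (* In degree 0 the only [y] is the empty tuple, whose vertices are trivially in [A]. *)
    case: (k) (z) zZ => [|k'] c cZ y yA; last by apply: cycle_bd cZ _.
    by exfalso; apply: yA => v; rewrite (tuple0 y).
  exists (z - bd e).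
    case: (k) (z) zZ zK (e) eK eA => [//|k'] c [_ bc] cK' e' eK' eA; split=> //.
    by rewrite [LHS](bd_sub_bd cK' eK').
  by rewrite opprB addrC subrK; exists e => //; exact: chainsS eK.
- move=> z /cycles_chains zA [c cc cz].
  have [|e eL eA] := retract_chain cL Lp cc.
    (* [bd c] is [z], whose vertices are in [A], so [c] is a cycle relative to [A] and can be pushed
       into [A] without changing its boundary. *)
    move=> y yA; rewrite [bd c]cz; apply/eqP; apply: contraT => zy.
    exfalso; apply: yA => v yv; case/chainsP: zA => _ /(_ y zy) [_ [_]] h _; apply: h.
    by rewrite /= inE.
  by exists (c - bd e) => //; rewrite [LHS](bd_sub_bd cc eL).
Qed.

End Retract.

(** * Relabelling of the vertices *)

Section Relabel.
Variables (F : fieldType) (T T' : choiceType).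
Variables (f : T -> T') (g : T' -> T) (A : set T) (A' : set T').
Hypothesis fA : forall x, A x -> A' (f x).
Hypothesis gA' : forall y, A' y -> A (g y).
Hypothesis gf : forall x, A x -> g (f x) = x.
Hypothesis fg : forall y, A' y -> f (g y) = y.

(** Push-forward along the bijection [f] from [A] to [A'], computed through its inverse [g]; the
    cutoff is there because [g] is arbitrary outside [A']. *)
Definition relabel n (c : n.-tuple T -> F^o) : n.-tuple T' -> F^o :=
  fun y => if `[< [set` y] `<=` A' >] then c (map_tuple g y) else 0.

Variables (K : set {fset T}) (K' : set {fset T'}).
Hypothesis KA : forall s, K s -> [set` s] `<=` A.
Hypothesis KK' : forall s, K s -> K' (f @` s)%fset.

Lemma relabel_neq0 n (c : n.-tuple T -> F^o) y :
  relabel c y != 0 -> [set` y] `<=` A' /\ c (map_tuple g y) != 0.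
Proof. by rewrite /relabel; case: asboolP; rewrite ?eqxx. Qed.

Lemma chains_relabel k (c : k.+1.-tuple T -> F^o) :
  @chains F T K k c -> @chains F T' K' k (relabel c).
Proof.
move=> /chainsP[[W cW] cK ca]; apply/chainsP; split.
- exists (f @` W)%fset => y /relabel_neq0[yA /cW gyW] v vy.
  by rewrite -(fg (yA _ vy)); apply: in_imfset; apply: gyW; apply: map_f.
- move=> y /relabel_neq0[yA /cK[/map_uniq uy Ky]]; split=> //.
  suff -> : [fset v in tval y]%fset =
      (f @` [fset v in tval (map_tuple g y)])%fset by apply: KK'.
  apply/fsetP => v; rewrite inE; apply/idP/imfsetP => /= [vy|[w]].
    by exists (g v); rewrite ?fg //; [rewrite inE map_f|apply: yA].
  by rewrite inE => /mapP[u uy' ->] ->; rewrite fg //; apply: yA.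
- move=> s y; rewrite /relabel.
  have -> : [set` tact s y] = [set` y].
    by apply/seteqP; split=> v /=; rewrite mem_tact.
  case: asboolP => // _; last by rewrite mulr0.
  by rewrite -ca; congr c; apply: eq_from_tnth => i; rewrite !(tnth_map, tnth_mktuple).
Qed.

Lemma bd_relabel k (c : k.+1.-tuple T -> F^o) :
  @chains F T K k c -> bd (relabel c) = relabel (bd c).
Proof.
move=> /chainsP[_ cK _]; apply/funext => y; rewrite [RHS]/relabel.
case: asboolP => yA; last first.
  apply: fsbig1 => v _; rewrite /relabel; case: asboolP => // vyA.
  by exfalso; apply: yA => w wy; apply: vyA; rewrite /= inE wy orbT.
have gbij : set_bij A' A g.
  split=> [v /gA' //|v w vA wA e|v vA].
    by rewrite !inE in vA wA; rewrite -(fg vA) -(fg wA) e.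
  by exists (f v); [apply: fA|apply: gf].
have cA x : c x != 0 -> [set` x] `<=` A.
  by move=> /cK[_ /KA xA] v vx; apply: xA; rewrite /= inE.
transitivity (\sum_(v \in A) c [tuple of v :: map_tuple g y]); last first.
  apply: fsbig_widen => // v [_ vA] /=; apply/eqP; apply: contraT => /cA h.
  by exfalso; apply: vA; apply: h; rewrite /= inE eqxx.
rewrite (reindex_fsbig g A' A) //.
transitivity (\sum_(v \in A') relabel c [tuple of v :: y]).
  apply/esym/fsbig_widen => // v [_ vA] /=; rewrite /relabel.
  case: asboolP => // h; exfalso; apply: vA; apply: h.
  by rewrite /= inE eqxx.
apply: eq_fsbigr => v; rewrite inE => vA; rewrite /relabel.
case: asboolP => [_|h]; first by congr c; apply: val_inj.
exfalso; apply: h => w; rewrite /= inE => /predU1P[->//|]; exact: yA.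
Qed.

Lemma cycles_relabel k (c : k.+1.-tuple T -> F^o) :
  @cycles F T K k c -> @cycles F T' K' k (relabel c).
Proof.
case: k c => [|k] c; first exact: chains_relabel.
move=> [cK bc]; split; first exact: chains_relabel.
rewrite [LHS](bd_relabel cK) [bd c]bc; apply/funext => y; rewrite /relabel.
by case: asboolP.
Qed.

Lemma boundaries_relabel k (c : k.+1.-tuple T -> F^o) :
  @boundaries F T K k c -> @boundaries F T' K' k (relabel c).
Proof.
move=> [e eK <-]; exists (relabel e); first exact: chains_relabel.
exact: bd_relabel.
Qed.

Lemma relabel_sum m n (a : 'I_n -> F) (z : 'I_n -> m.-tuple T -> F^o) :
  relabel (\sum_i a i *: z i) = \sum_i a i *: relabel (z i).
Proof.
apply/funext => y; rewrite [X in _ = X y]fct_sumE [LHS]/relabel.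
case: asboolP => yA.
  rewrite fct_sumE; apply: eq_bigr => i _.
  by rewrite -[RHS]/(a i * relabel (z i) y) /relabel asboolT.
rewrite big1 // => i _.
by rewrite -[LHS]/(a i * relabel (z i) y) /relabel asboolF // mulr0.
Qed.

End Relabel.

Lemma relabelK (F : fieldType) (T T' : choiceType) (f : T -> T') (g : T' -> T)
    (A : set T) (A' : set T') (K : set {fset T}) k (c : k.+1.-tuple T -> F^o) :
  (forall x, A x -> A' (f x)) -> (forall x, A x -> g (f x) = x) ->
  (forall s, K s -> [set` s] `<=` A) -> @chains F T K k c ->
  relabel f A (relabel g A' c) = c.
Proof.
move=> fA gf KA /chainsP[_ cK _]; apply/funext => x; rewrite /relabel.
case: asboolP => xA; last first.
  apply/esym/eqP; apply: contraT => /cK[_ /KA h]; exfalso; apply: xA => v vx.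
  by apply: h; rewrite /= inE.
case: asboolP => [_|h]; last first.
  by exfalso; apply: h => v /= /mapP[w wx ->]; apply: fA; apply: xA.
congr c; apply: eq_from_tnth => i; rewrite !tnth_map gf //.
by apply: xA; apply: mem_tnth.
Qed.

(** Cycles go forward along [f] and boundaries come back along [g], whence the opposite directions
    of the conditions on [K] and on [L]. *)
Lemma dim_mod_ge_relabel (F : fieldType) (T T' : choiceType)
    (f : T -> T') (g : T' -> T) (A : set T) (A' : set T')
    (K L : set {fset T}) (K' L' : set {fset T'}) k n :
  (forall x, A x -> A' (f x)) -> (forall y, A' y -> A (g y)) ->
  (forall x, A x -> g (f x) = x) -> (forall y, A' y -> f (g y) = y) ->
  (forall s, K s -> [set` s] `<=` A) ->
  (forall s, L' s -> [set` s] `<=` A') ->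
  (forall s, K s -> K' (f @` s)%fset) -> (forall s, L' s -> L (g @` s)%fset) ->
  dim_mod_ge (@cycles F T K k) (@boundaries F T L k) n ->
  dim_mod_ge (@cycles F T' K' k) (@boundaries F T' L' k) n.
Proof.
move=> fA gA gf fg KA LA KK LL.
apply: (@dim_mod_ge_section F (k.+1.-tuple T -> F^o) (k.+1.-tuple T' -> F^o)
  _ _ _ _ (@relabel F T T' g A' k.+1) (@relabel F T' T f A k.+1)).
- by move=> m a z; apply: relabel_sum.
- by move=> z; apply: (cycles_relabel fA gA gf fg KA KK).
- by move=> z; apply: (boundaries_relabel gA fA fg gf LA LL).
- by move=> z /cycles_chains; apply: relabelK.
Qed.

Lemma dim_mod_ge_empty (F : fieldType) (T : choiceType) (K L : set {fset T})
    k n : (forall s, K s -> [set` s] `<=` set0) ->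
  dim_mod_ge (@cycles F T K k) (@boundaries F T L k) n <-> n = 0%N.
Proof.
move=> K0; split=> [[z [Zz fz]]|->]; last by exists (fun=> 0); split=> [[]|a _ []].
case: n z Zz fz => // n z Zz /(_ (fun i => (i == ord0)%:R)) fz.
have z0 i : z i = 0.
  have /chainsP[_ zK _] := cycles_chains (Zz i).
  apply/funext => x; apply/eqP; apply: contraT => /zK[_ /K0 h].
  by exfalso; apply: (h (tnth x ord0)); rewrite /= inE mem_tnth.
have /fz /(_ ord0) /eqP : @boundaries F T L k
    (\sum_(i < n.+1) (i == ord0)%:R *: z i).
  rewrite big1 => [|i _]; first by case: (subspace_boundaries F L k).
  by rewrite z0 scaler0.
by rewrite eqxx oner_eq0.
Qed.

(** * Pull-back of a complex along a map that may identify vertices *)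

Section Preimage.
Variables (F : fieldType) (T T' : choiceType) (f : T -> T') (S : set T).

Definition preimage_complex (M : set {fset T'}) : set {fset T} :=
  [set s | [/\ s != fset0, [set` s] `<=` S & M (f @` s)%fset]].

Lemma complex_preimage M : complex M -> complex (preimage_complex M).
Proof.
move=> cM s t [_ sS Ms] t0 ts; split=> // [v /(fsubsetP ts) /sS //|].
apply: (cM _ _ Ms).
  have /fset0Pn[v vt] := t0; apply/fset0Pn; exists (f v); exact: in_imfset.
apply/fsubsetP => _ /imfsetP[v /= vt ->]; apply: in_imfset.
exact: (fsubsetP ts).
Qed.

Lemma preimage_complexS M N : M `<=` N ->
  preimage_complex M `<=` preimage_complex N.
Proof. by move=> MN s [s0 sS /MN]. Qed.

(** A section [g] of [f] over its image selects one representative in each fibre, and [p] sends a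
    vertex to the representative of its fibre. Adding [p v] to a simplex containing [v] does not
    change its image, so the simplex stays in the pull-back and all vertices can be moved to
    representatives. On these, [f] is a bijection. *)
Lemma dim_mod_ge_preimage (K L : set {fset T'}) k n :
  complex K -> complex L -> K `<=` L ->
  (forall s, L s -> s != fset0 /\ [set` s] `<=` f @` S) ->
  dim_mod_ge (@cycles F T (preimage_complex K) k)
    (@boundaries F T (preimage_complex L) k) n <->
  dim_mod_ge (@cycles F T' K k) (@boundaries F T' L k) n.
Proof.
move=> cK cL KL LS.
have [[x0 Sx0]|S0] := pselect (exists x, S x); last first.
  (* Without a point in [S] there is no section, but both complexes are empty. *)
  have {}S0 : S = set0 by apply/eqP; apply: contrapT => /negP/set0P.
  rewrite !dim_mod_ge_empty // => [s /KL /LS[_]|s [_]]; rewrite S0 //.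
  by rewrite image_set0.
have /choice [g hg] : forall y, exists x, S x /\ ((f @` S) y -> f x = y).
  move=> y; have [[x Sx e]|ny] := pselect ((f @` S) y); first by exists x.
  by exists x0.
have gS y : S (g y) by case: (hg y).
have fg y : (f @` S) y -> f (g y) = y by case: (hg y).
pose A := g @` (f @` S).
(* [p] has to take its values in [A] everywhere; off [S], where no simplex has vertices, a constant
   is used. *)
pose p v := if `[<S v>] then g (f v) else g (f x0).
have Sf v : S v -> (f @` S) (f v) by exists v.
have pA v : A (p v).
  by rewrite /p; case: asboolP => Sv; [exists (f v)|exists (f x0)] => //; apply: Sf.
have Mp M s v : preimage_complex M s -> v \in s ->
    preimage_complex M (p v |` s)%fset.
  move=> [s0 sS Ms] vs; have Sv : S v by exact: sS.
  split=> [|w|].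
  - by apply/fset0Pn; exists (p v); rewrite !inE eqxx.
  - rewrite /= !inE => /orP[/eqP ->|/sS //].
    by rewrite /p; case: asboolP.
  - suff -> : (f @` (p v |` s) = f @` s)%fset by [].
    apply/fsetP => w; apply/imfsetP/imfsetP => /= -[u us ->].
      move: us; rewrite !inE => /orP[/eqP ->|us]; last by exists u.
      exists v => //; rewrite /p asboolT // fg //; exact: Sf.
    by exists u => //; rewrite !inE us orbT.
rewrite (@dim_mod_ge_full_subcomplex F T A p pA) //; last 5 first.
- exact: complex_preimage.
- exact: complex_preimage.
- exact: preimage_complexS.
- exact: Mp.
- exact: Mp.
have fA x : A x -> (f @` S) (f x) by move=> [y Sy <-]; rewrite fg.
have gA y : (f @` S) y -> A (g y) by exists y.
have gf x : A x -> g (f x) = x by move=> [y Sy <-]; rewrite fg.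
have gM (M : set {fset T'}) s : (forall s, M s -> s != fset0 /\ [set` s] `<=` f @` S) ->
    M s -> full_subcomplex (preimage_complex M) A (g @` s)%fset.
  move=> MS Ms; have [s0 sS] := MS s Ms; split; last first.
    by move=> _ /imfsetP[v /= /sS vs ->]; apply: gA.
  split=> [|_ /imfsetP[v /= /sS vs ->] //|].
    have /fset0Pn[v vs] := s0; apply/fset0Pn; exists (g v); exact: in_imfset.
  suff -> : (f @` (g @` s) = s)%fset by [].
  apply/fsetP => w; apply/imfsetP/idP => /= [[_ /imfsetP[v /= vs ->] ->]|ws].
    by rewrite fg //; apply: sS.
  by exists (g w); [apply: in_imfset|rewrite fg //; apply: sS].
split.
  apply: (dim_mod_ge_relabel (f := f) (g := g) (A := A) (A' := f @` S)) => //.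
  - by move=> s [].
  - by move=> s /LS[].
  - by move=> s [[]].
  - by move=> s; apply: gM.
apply: (dim_mod_ge_relabel (f := g) (g := f) (A := f @` S) (A' := A)) => //.
- by move=> s /KL /LS[].
- by move=> s [].
- by move=> s; apply: gM => t /KL /LS.
- by move=> s [[]].
Qed.

End Preimage.

(** * Jumps of step functions *)

Section MinNat.

Lemma min_natP (A : set nat) n : A n ->
  A (min_nat A) /\ forall m, A m -> (min_nat A <= m)%N.
Proof.
move=> An; have ex : exists n, `[<A n>] by exists n; apply/asboolP.
case: (ex_minnP ex) => m /asboolP Am minm.
rewrite /min_nat; apply: (@xgetPex _ 0%N [set n | A n /\ forall m, A m -> (n <= m)%N]).
by exists m; split=> // k Ak; apply: minm; apply/asboolP.
Qed.

Lemma min_nat0 (A : set nat) : (forall n, ~ A n) -> min_nat A = 0%N.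
Proof. by move=> A0; apply: xgetPN => n [/A0]. Qed.

End MinNat.

Lemma ereal_between (R : realType) (x y : \bar R) : (x < y)%E ->
  exists r : R, (x < r%:E)%E /\ (r%:E < y)%E.
Proof.
case: x y => [x||] [y||] //=; rewrite ?lte_fin => xy.
- by exists ((x + y) / 2); split; rewrite lte_fin !midf_lt.
- by exists (x + 1); rewrite lte_fin ltrDl ltr01 ltry.
- by exists (y - 1); rewrite lte_fin ltrBlDr ltrDl ltr01 ltNyr.
- by exists 0; rewrite ltNyr ltry.
Qed.

Section Codes.
Variable R : realType.
Implicit Types (e c : \bar R).

(* [+oo] is above itself, so that infinite bars need no separate treatment. *)
Definition above e c := (e < c)%E || (e == +oo%E) && (c == +oo%E).

Lemma above_le e c : above e c -> (e <= c)%E.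
Proof. by case/orP => [/ltW //|/andP[/eqP -> /eqP ->]]. Qed.

Lemma above_min e c c' : above e c -> above e c' -> above e (Order.min c c').
Proof. by move=> h h'; rewrite /Order.min; case: ifP. Qed.

(* [N c] stands for the number of bars, among those with a given birth [beta],
   that are alive at [c], and [m e] for the number of those that die at [e]. *)
Definition step_function (N m : \bar R -> nat) (beta : \bar R) := [/\
  N +oo%E = 0%N,
  forall c c', (beta < c)%E -> (c <= c')%E -> (N c' <= N c)%N,
  forall e, (e <= beta)%E -> m e = 0%N &
  forall e, (beta < e)%E -> exists c1 c2,
    [/\ (beta < c1 < e)%E, above e c2 &
      forall c1' c2', (c1 <= c1' < e)%E -> above e c2' -> (c2' <= c2)%E ->
        N c1' = (m e + N c2')%N]].

Variables (N m : \bar R -> nat) (beta : \bar R).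
Hypothesis hN : step_function N m beta.

Let Noo : N +oo%E = 0%N. Proof. by case: hN. Qed.

Let Nmono c c' : (beta < c)%E -> (c <= c')%E -> (N c' <= N c)%N.
Proof. by case: hN => _ h _ _; apply: h. Qed.

(** The number of bars that die strictly after [e]. For [e = +oo] the only admissible argument is
    [+oo] itself, where [N] is 0. *)
Definition right_limit e : nat := xget 0%N
  [set n | exists2 c2, above e c2 &
    forall c, above e c -> (c <= c2)%E -> N c = n].

Lemma right_limitP e : (beta < e)%E -> exists c1 c2,
  [/\ (beta < c1 < e)%E, above e c2,
      forall c, (c1 <= c < e)%E -> N c = (m e + right_limit e)%N &
      forall c, above e c -> (c <= c2)%E -> N c = right_limit e].
Proof.
case: hN => _ _ _ Nm /Nm[c1 [c2 [c1e ec2 h]]]; exists c1, c2.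
have c11 : (c1 <= c1 < e)%E by rewrite lexx; case/andP: c1e.
have hc c : above e c -> (c <= c2)%E -> N c = N c2.
  move=> ec cc2; have := h c1 c c11 ec cc2.
  by rewrite (h c1 c2 c11 ec2 (lexx _)) => /addnI.
have lim : right_limit e = N c2.
  apply: xget_unique; first by exists c2.
  move=> n [c ec hn].
  have emin : above e (Order.min c c2) by apply: above_min.
  by rewrite -(hn _ emin) ?hc // ge_min lexx ?orbT.
split=> // [c cc|c ec cc2]; last by rewrite lim; apply: hc.
by rewrite (h c c2 cc ec2 (lexx _)) lim.
Qed.

Lemma m_gt0 e j : (j < m e)%N -> (beta < e)%E.
Proof. by case: hN => _ _ m0 _; rewrite ltNge; apply: contraTN => /m0 ->. Qed.

(* Numbering the bars by decreasing death gives those that die at [e] the codes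
   [right_limit e + j] with [j < m e]. *)
Lemma code_lt e j c : (j < m e)%N -> (beta < c)%E -> (c < e)%E ->
  (right_limit e + j < N c)%N.
Proof.
move=> jm bc ce; have [c1 [c2 [/andP[bc1 c1e] _ h _]]] := right_limitP (m_gt0 jm).
have cm : (c1 <= Order.max c c1 < e)%E by rewrite le_max lexx orbT gt_max ce c1e.
have : (N (Order.max c c1) <= N c)%N by apply: Nmono; rewrite ?le_max ?lexx.
by rewrite (h _ cm); lia.
Qed.

(** Together with [code_lt]: away from its endpoints, a bar is alive at [c] exactly when its code is
    less than [N c]. Comparing the deaths of bars with equal codes thus amounts to comparing
    counts. *)
Lemma code_ge e j c : (j < m e)%N -> above e c ->
  (N c <= right_limit e + j)%N.
Proof.
move=> jm ec; have be := m_gt0 jm.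
have [c1 [c2 [_ ec2 _ h]]] := right_limitP be.
have em := above_min ec ec2.
have : (N c <= N (Order.min c c2))%N.
  apply: Nmono; last by rewrite ge_min lexx.
  exact: lt_le_trans be (above_le em).
by rewrite (h _ em) ?ge_min ?lexx ?orbT //; lia.
Qed.

(** The bar with code [i] dies at the supremum of the parameters where more than [i] bars are alive:
    the count is above [i] just before it and at most [i] just after. *)
Lemma code_exists c i : (beta < c)%E -> (i < N c)%N ->
  exists e j, (j < m e)%N /\ (right_limit e + j)%N = i.
Proof.
move=> bc ic; pose E := [set c | (beta < c)%E /\ (i < N c)%N].
have Ec : E c by [].
pose e := ereal_sup E.
have be : (beta < e)%E by apply: lt_le_trans bc _; apply: ereal_sup_ubound.
have [c1 [c2 [/andP[bc1 c1e] ec2 h1 h2]]] := right_limitP be.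
have [x [bx ix] c1x] := ereal_sup_gt c1e.
have N1 : (i < N c1)%N by apply: leq_trans ix _; apply: Nmono => //; apply: ltW.
rewrite h1 ?lexx // in N1.
have N2 : (N c2 <= i)%N.
  rewrite leqNgt; apply/negP => ic2.
  have bc2 : (beta < c2)%E by apply: lt_le_trans be _; apply: above_le.
  have c2e : (c2 <= e)%E by apply: ereal_sup_ubound.
  case/orP: ec2 => [/lt_geF|/andP[_ /eqP c2oo]]; first by rewrite c2e.
  by move: ic2; rewrite c2oo Noo.
rewrite h2 // in N2.
by exists e, (i - right_limit e)%N; split; lia.
Qed.

Lemma code_inj e e' j j' : (j < m e)%N -> (j' < m e')%N ->
  (right_limit e + j = right_limit e' + j')%N -> e = e'.
Proof.
wlog ee : e e' j j' / (e < e')%E.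
  move=> hw jm jm' ejj; case: (ltgtP e e') => // ee; first exact: (hw _ _ _ _ ee jm jm').
  by apply/esym; apply: (hw _ _ _ _ ee jm' jm).
move=> jm jm' ejj; have [y [ey ye']] := ereal_between ee.
have be := m_gt0 jm.
have := code_lt jm' (lt_trans be ey) ye'.
have : above e y%:E by rewrite /above ey.
by move=> /(code_ge jm); lia.
Qed.

End Codes.

(** * Diagrams of rank functions *)

(** Passes from additive rank inequalities to truncated differences without first showing that these
    are exact. *)
Lemma leq_sub_cross (p q p' q' : nat) :
  (p' + q <= p + q')%N -> (p' - q' <= p - q)%N.
Proof. by lia. Qed.

Section RankFunction.
Variable R : realType.
Implicit Types (a b : R) (c d : \bar R).

(** Only pairs [a < c] are constrained, since ranks are finite only there. The last condition
    excludes births at [-oo]. *)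
Definition rank_function (r : R -> R -> nat) := [/\
  forall a1 a2 (c : R), a1 <= a2 -> a2 < c -> (r a1 c <= r a2 c)%N,
  forall a (c1 c2 : R), a < c1 -> c1 <= c2 -> (r a c2 <= r a c1)%N,
  forall a1 a2 (c1 c2 : R), a1 <= a2 -> a2 < c1 -> c1 <= c2 ->
    (r a1 c1 + r a2 c2 <= r a2 c1 + r a1 c2)%N &
  forall a (c : R), a < 0 -> a < c -> r a c = 0%N].

Variable r : R -> R -> nat.
Hypothesis hr : rank_function r.

Definition rbar a c : nat := if c is c'%:E then r a c' else 0%N.

Lemma rbar_homo_l a1 a2 c : a1 <= a2 -> (a2%:E < c)%E ->
  (rbar a1 c <= rbar a2 c)%N.
Proof. by case: hr => h _ _ _; case: c => //= c; rewrite lte_fin; apply: h. Qed.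

Lemma rbar_anti_r a c1 c2 : (a%:E < c1)%E -> (c1 <= c2)%E ->
  (rbar a c2 <= rbar a c1)%N.
Proof.
case: hr => _ h _ _; case: c1 c2 => [c1||] [c2||] //=.
by rewrite lte_fin lee_fin; apply: h.
Qed.

Lemma rbar_frobenius a1 a2 c1 c2 : a1 <= a2 -> (a2%:E < c1)%E -> (c1 <= c2)%E ->
  (rbar a1 c1 + rbar a2 c2 <= rbar a2 c1 + rbar a1 c2)%N.
Proof.
case: hr => h1 _ h _; case: c1 c2 => [c1||] [c2||] //= a12.
  by rewrite lte_fin lee_fin; apply: h.
by rewrite lte_fin => ac _; rewrite !addn0; apply: h1.
Qed.

Definition box a1 a2 c1 c2 : nat :=
  (rbar a2 c1 + rbar a1 c2 - (rbar a1 c1 + rbar a2 c2))%N.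

(** The larger box is the smaller one surrounded by four strips, each of nonnegative measure by
    Frobenius' inequality. *)
Lemma box_le a1 a2 c1 c2 a1' a2' c1' c2' :
  a1 <= a1' -> a1' <= a2' -> a2' <= a2 -> (a2%:E < c1)%E ->
  (c1 <= c1')%E -> (c1' <= c2')%E -> (c2' <= c2)%E ->
  (box a1' a2' c1' c2' <= box a1 a2 c1 c2)%N.
Proof.
move=> a11 a12 a22 ac c11 c12 c22; rewrite /box.
have a2c : (a2'%:E < c1)%E by apply: le_lt_trans ac; rewrite lee_fin.
have a1c : (a1'%:E < c1)%E by apply: le_lt_trans a2c; rewrite lee_fin.
have acc : (a2'%:E < c1')%E by apply: lt_le_trans c11.
have c1c2 : (c1 <= c2)%E by apply: le_trans c11 _; apply: le_trans c22.
have c1c2' : (c1 <= c2')%E by apply: le_trans c12.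
have h1 := rbar_frobenius a22 ac c1c2.
have h2 := rbar_frobenius a11 a1c c1c2.
have h3 := rbar_frobenius a12 a2c c11.
have h4 := rbar_frobenius a12 (lt_le_trans a2c c1c2') c22.
by apply: leq_sub_cross; clear -h1 h2 h3 h4; lia.
Qed.

(** Measures of boxes are natural numbers, so the minimum is attained by some box, and by [box_le]
    it is kept by all smaller boxes around the point. *)
Lemma diagram_stable b d : (b%:E < d)%E -> exists a1 a2 c1 c2,
  [/\ a1 < b < a2, (a2%:E < c1)%E, (c1 < d)%E, above d c2 &
    forall a1' a2' c1' c2', a1 <= a1' < b -> b < a2' <= a2 ->
      (c1 <= c1' < d)%E -> above d c2' -> (c2' <= c2)%E ->
      diagram_of_rank r (b, d) = box a1' a2' c1' c2'].
Proof.
move=> bd; have [a2 [ba2 a2d]] := ereal_between bd.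
have [c1 [ac1 c1d]] := ereal_between a2d.
rewrite !lte_fin in ba2 ac1.
have b1 : b - 1 < b by rewrite ltrBlDr ltrDl ltr01.
case: d bd a2d c1d => [d||] // bd a2d c1d.
- rewrite !lte_fin in bd a2d c1d.
  set A := [set m | exists a1 a2 c1 c2 : R,
    [/\ a1 < b < a2, a2 < c1, c1 < d < c2 &
        m = (r a2 c1 + r a1 c2 - (r a1 c1 + r a2 c2))%N]].
  have Am : A (r a2 c1 + r (b - 1) (d + 1) - (r (b - 1) c1 + r a2 (d + 1)))%N.
    exists (b - 1), a2, c1, (d + 1); split=> //; first by rewrite b1.
    by rewrite c1d ltrDl ltr01.
  have [] := min_natP Am.
  rewrite -[min_nat A]/(diagram_of_rank r (b, d%:E)).
  move=> [a1 [a2' [c1' [c2 [/andP[a1b ba2'] ac' /andP[cd' dc'] e]]]]] minA.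
  exists a1, a2', c1'%:E, c2%:E; split; rewrite ?lte_fin //.
  + by rewrite a1b.
  + by rewrite /above lte_fin dc'.
  + move=> x1 x2 y1 y2 /andP[ax1 x1b] /andP[bx2 xa2] /andP[cy1 y1d] dy2 yc2.
    case: y1 cy1 y1d => [y1||] //; rewrite lee_fin lte_fin => cy1 y1d.
    case: y2 dy2 yc2 => [y2||] //.
    rewrite /above lee_fin lte_fin orbF => dy2 yc2.
    have x12 : x1 <= x2 by apply/ltW/(lt_trans x1b).
    have y12 : y1 <= y2 by apply/ltW/(lt_trans y1d).
    apply/eqP; rewrite eqn_leq; apply/andP; split.
      apply: minA; exists x1, x2, y1, y2; split; rewrite ?x1b ?y1d //.
      by apply: le_lt_trans xa2 _; apply: lt_le_trans cy1.
    by rewrite e; apply: (@box_le a1 a2' c1'%:E c2%:E); rewrite ?lee_fin ?lte_fin.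
- set A := [set m | exists a1 a2 c1 : R,
    [/\ a1 < b < a2, a2 < c1 & m = (r a2 c1 - r a1 c1)%N]].
  have Am : A (r a2 c1 - r (b - 1) c1)%N.
    by exists (b - 1), a2, c1; rewrite b1.
  have [] := min_natP Am.
  rewrite -[min_nat A]/(diagram_of_rank r (b, +oo%E)).
  move=> [a1 [a2' [c1' [/andP[a1b ba2'] ac' e]]]] minA.
  exists a1, a2', c1'%:E, +oo%E; split; rewrite ?lte_fin ?ltry //.
  + by rewrite a1b.
  + move=> x1 x2 y1 y2 /andP[ax1 x1b] /andP[bx2 xa2] /andP[cy1 y1d] dy2 yc2.
    case: y1 cy1 y1d => [y1||] //; rewrite lee_fin => cy1 _.
    have -> : y2 = +oo%E by case/orP: dy2 => [|/andP[_ /eqP //]]; rewrite ltNge leey.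
    have x12 : x1 <= x2 by apply/ltW/(lt_trans x1b).
    apply/eqP; rewrite eqn_leq; apply/andP; split.
      apply: minA; exists x1, x2, y1; split; rewrite ?x1b //.
        by apply: le_lt_trans xa2 _; apply: lt_le_trans cy1.
      by rewrite /box /= !addn0.
    have -> : diagram_of_rank r (b, +oo%E) = box a1 a2' c1'%:E +oo%E.
      by rewrite /box /= !addn0.
    by apply: box_le; rewrite ?lee_fin ?lte_fin ?leey.
Qed.

Lemma diagram0 b d : (d <= b%:E)%E -> diagram_of_rank r (b, d) = 0%N.
Proof.
case: d => [d||] //; rewrite lee_fin => db; apply: min_nat0 => n.
move=> [a1 [a2 [c1 [c2 [/andP[_ ba2] ac /andP[cd _] _]]]]].
by move: (lt_trans ba2 (lt_trans ac cd)); rewrite ltNge db.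
Qed.

(* The number of points with birth [b] still alive at [c]. *)
Definition birth_count b c : nat := min_nat [set m | exists a1 a2,
  [/\ a1 < b < a2, (a2%:E < c)%E & m = (rbar a2 c - rbar a1 c)%N]].

Lemma birth_count_le b c a1 a2 : a1 < b < a2 -> (a2%:E < c)%E ->
  (birth_count b c <= rbar a2 c - rbar a1 c)%N.
Proof.
move=> ab ac; set n := (rbar a2 c - rbar a1 c)%N.
by case: (@min_natP [set m | exists a1 a2,
  [/\ a1 < b < a2, (a2%:E < c)%E & m = (rbar a2 c - rbar a1 c)%N]] n) => [|_];
  [exists a1, a2|apply; exists a1, a2].
Qed.

Lemma birth_count_stable b c : (b%:E < c)%E -> exists a1 a2,
  [/\ a1 < b < a2, (a2%:E < c)%E &
    forall a1' a2', a1 <= a1' < b -> b < a2' <= a2 ->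
      birth_count b c = (rbar a2' c - rbar a1' c)%N].
Proof.
move=> bc; have [a2 [ba2 a2c]] := ereal_between bc; rewrite lte_fin in ba2.
set A := [set m | exists a1 a2,
  [/\ a1 < b < a2, (a2%:E < c)%E & m = (rbar a2 c - rbar a1 c)%N]].
have Am : A (rbar a2 c - rbar (b - 1) c)%N.
  by exists (b - 1), a2; rewrite ltrBlDr ltrDl ltr01.
have [[a1 [a2' [/andP[a1b ba2'] ac' e]]] minA] := min_natP Am.
exists a1, a2'; split=> //; first by rewrite a1b.
move=> x1 x2 /andP[ax1 x1b] /andP[bx2 xa2].
have x2c : (x2%:E < c)%E by apply: le_lt_trans ac'; rewrite lee_fin.
have x1c : (x1%:E < c)%E.
  by apply: lt_trans x2c; rewrite lte_fin; apply: lt_trans bx2.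
apply/eqP; rewrite eqn_leq; apply/andP; split.
  by apply: minA; exists x1, x2; rewrite x1b.
rewrite -[birth_count b c]/(min_nat A) e.
have := rbar_homo_l ax1 x1c; have := rbar_homo_l xa2 ac'; clear; lia.
Qed.

Lemma birth_count_anti b c c' : (b%:E < c)%E -> (c <= c')%E ->
  (birth_count b c' <= birth_count b c)%N.
Proof.
move=> bc cc'; have [a1 [a2 [/andP[a1b ba2] ac h]]] := birth_count_stable bc.
rewrite (h a1 a2) ?lexx ?a1b ?ba2 //.
have := @birth_count_le b c' a1 a2; rewrite a1b ba2 => /(_ isT (lt_le_trans ac cc')).
have a12 : a1 <= a2 by apply/ltW/(lt_trans a1b).
have := rbar_frobenius a12 ac cc'.
have := rbar_homo_l a12 ac; have := rbar_homo_l a12 (lt_le_trans ac cc').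
clear; lia.
Qed.

Lemma birth_count_jump b d : (b%:E < d)%E -> exists c1 c2,
  [/\ (b%:E < c1 < d)%E, above d c2 &
      forall c1' c2', (c1 <= c1' < d)%E -> above d c2' -> (c2' <= c2)%E ->
        birth_count b c1' =
        (diagram_of_rank r (b, d) + birth_count b c2')%N].
Proof.
move=> bd; have [a1 [a2 [c1 [c2 [/andP[a1b ba2] ac1 c1d dc2 h]]]]] :=
  diagram_stable bd.
have bc1 : (b%:E < c1)%E by apply: lt_trans ac1; rewrite lte_fin.
exists c1, c2; split=> //; first by rewrite bc1.
move=> c1' c2' /andP[cc1 c1d'] dc2' cc2.
have bc1' : (b%:E < c1')%E by apply: lt_le_trans cc1.
have c12 : (c1' <= c2')%E by apply/ltW/(lt_le_trans c1d')/above_le.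
have bc2' : (b%:E < c2')%E by apply: lt_le_trans c12.
have [x1 [x2 [/andP[x1b bx2] xc hx]]] := birth_count_stable bc1'.
have [y1 [y2 [/andP[y1b by2] yc hy]]] := birth_count_stable bc2'.
(* A neighbourhood of [b] on which the multiplicity and both counts have reached their limits; there
   the claim is the definition of the measure of a box. *)
pose z1 := Order.max a1 (Order.max x1 y1); pose z2 := Order.min a2 (Order.min x2 y2).
have z1b : z1 < b by rewrite !gt_max a1b x1b y1b.
have bz2 : b < z2 by rewrite !lt_min ba2 bx2 by2.
have z2x : z2 <= x2 by rewrite !ge_min lexx !orbT.
have z2c : (z2%:E < c1')%E by apply: le_lt_trans xc; rewrite lee_fin.
have z12 : z1 <= z2 by apply/ltW/(lt_trans z1b).
rewrite (hx z1 z2) ?(hy z1 z2) ?(h z1 z2 c1' c2') ?z1b ?bz2 ?cc1 //;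
  rewrite ?le_max ?ge_min ?lexx ?orbT //.
rewrite /box.
have := rbar_frobenius z12 z2c c12.
have := rbar_homo_l z12 z2c; have := rbar_homo_l z12 (lt_le_trans z2c c12).
clear; lia.
Qed.

(* The number of points with death [d] already born at [a]. *)
Definition death_count d a : nat := min_nat [set m | exists c1 c2,
  [/\ (a%:E < c1)%E, (c1 < d)%E, above d c2 & m = (rbar a c1 - rbar a c2)%N]].

Lemma death_count_le d a c1 c2 : (a%:E < c1)%E -> (c1 < d)%E -> above d c2 ->
  (death_count d a <= rbar a c1 - rbar a c2)%N.
Proof.
move=> ac cd dc; set n := (rbar a c1 - rbar a c2)%N.
by case: (@min_natP [set m | exists c1 c2,
  [/\ (a%:E < c1)%E, (c1 < d)%E, above d c2 & m = (rbar a c1 - rbar a c2)%N]] n)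
  => [|_]; [exists c1, c2|apply; exists c1, c2].
Qed.

Lemma above_exists d : (-oo < d)%E -> exists c, above d c.
Proof.
case: d => [d||] // _; last by exists +oo%E; rewrite /above !eqxx orbC.
by exists +oo%E; rewrite /above ltry.
Qed.

Lemma death_count_stable d a : (a%:E < d)%E -> exists c1 c2,
  [/\ (a%:E < c1)%E, (c1 < d)%E, above d c2 &
    forall c1' c2', (c1 <= c1' < d)%E -> above d c2' -> (c2' <= c2)%E ->
      death_count d a = (rbar a c1' - rbar a c2')%N].
Proof.
move=> ad; have [x1 [ax1 x1d]] := ereal_between ad.
have [x2 dx2] := above_exists (lt_trans (ltNyr a) ad).
set A := [set m | exists c1 c2,
  [/\ (a%:E < c1)%E, (c1 < d)%E, above d c2 & m = (rbar a c1 - rbar a c2)%N]].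
have Am : A (rbar a x1%:E - rbar a x2)%N by exists x1%:E, x2.
have [[c1 [c2 [ac1 c1d dc2 e]]] minA] := min_natP Am.
exists c1, c2; split=> // y1 y2 /andP[cy yd] dy2 yc2.
have y12 : (y1 <= y2)%E by apply/ltW/(lt_le_trans yd)/above_le.
have ay1 := lt_le_trans ac1 cy.
apply/eqP; rewrite eqn_leq; apply/andP; split.
  by apply: minA; exists y1, y2.
rewrite -[death_count d a]/(min_nat A) e.
have := rbar_anti_r ac1 cy; have := rbar_anti_r (lt_le_trans ay1 y12) yc2; clear; lia.
Qed.

Lemma death_count_homo d a a' : a <= a' -> (a'%:E < d)%E ->
  (death_count d a <= death_count d a')%N.
Proof.
move=> aa ad; have [c1 [c2 [ac1 c1d dc2 h]]] := death_count_stable ad.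
rewrite (h c1 c2) ?lexx //.
have ac : (a%:E < c1)%E by apply: le_lt_trans ac1; rewrite lee_fin.
have c12 : (c1 <= c2)%E by apply/ltW/(lt_le_trans c1d)/above_le.
have := death_count_le ac c1d dc2.
have := rbar_frobenius aa ac1 c12.
have := rbar_anti_r ac c12; have := rbar_anti_r ac1 c12; clear; lia.
Qed.

Lemma death_count0 d a : a < 0 -> (a%:E < d)%E -> death_count d a = 0%N.
Proof.
move=> a0 ad; have [c1 [ac1 c1d]] := ereal_between ad.
have [c2 dc2] := above_exists (lt_trans (ltNyr a) ad).
have := death_count_le ac1 c1d dc2.
case: hr => _ _ _ h /=; rewrite h // -?lte_fin //.
by rewrite sub0n leqn0 => /eqP.
Qed.

Lemma death_count_jump d b : (b%:E < d)%E -> exists a1 a2,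
  [/\ a1 < b < a2, (a2%:E < d)%E &
      forall a1' a2', a1 <= a1' < b -> b < a2' <= a2 ->
        death_count d a2' =
        (diagram_of_rank r (b, d) + death_count d a1')%N].
Proof.
move=> bd; have [a1 [a2 [c1 [c2 [/andP[a1b ba2] ac1 c1d dc2 h]]]]] :=
  diagram_stable bd.
exists a1, a2; split; rewrite ?a1b //; first exact: lt_trans c1d.
move=> x1 x2 /andP[ax1 x1b] /andP[bx2 xa2].
have x2c : (x2%:E < c1)%E by apply: le_lt_trans ac1; rewrite lee_fin.
have x2d := lt_trans x2c c1d.
have x12 : x1 <= x2 by apply/ltW/(lt_trans x1b).
have x1c : (x1%:E < c1)%E by apply: le_lt_trans x2c; rewrite lee_fin.
have x1d := lt_trans x1c c1d.
have [y1 [y2 [xy1 y1d dy2 hy]]] := death_count_stable x2d.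
have [w1 [w2 [xw1 w1d dw2 hw]]] := death_count_stable x1d.
pose z1 := Order.max c1 (Order.max y1 w1); pose z2 := Order.min c2 (Order.min y2 w2).
have z1d : (z1 < d)%E by rewrite !gt_max c1d y1d w1d.
have dz2 : above d z2 by do !apply: above_min.
have z12 : (z1 <= z2)%E by apply/ltW/(lt_le_trans z1d)/above_le.
have xz1 : (x2%:E < z1)%E by rewrite lt_max x2c.
rewrite (hy z1 z2) ?(hw z1 z2) ?(h x1 x2 z1 z2) ?z1d ?ax1 ?bx2 ?x1b //;
  rewrite ?le_max ?ge_min ?lexx ?orbT //.
have xz1' : (x1%:E < z1)%E by rewrite lt_max x1c.
rewrite /box.
have := rbar_frobenius x12 xz1 z12.
have := rbar_anti_r xz1 z12; have := rbar_anti_r xz1' z12.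
clear; lia.
Qed.

End RankFunction.

(** * Numbering the points of a diagram *)

Section PointCodes.
Variable R : realType.
Variable r : R -> R -> nat.
Hypothesis hr : rank_function r.
Local Notation D := (diagram_of_rank r).

(* Reversal of the order turns births into deaths. *)
Definition rev_death_count (d : \bar R) (c : \bar R) : nat :=
  if c is c'%:E then death_count r d (- c') else 0%N.

Lemma point_eq (x y : Defs.point D) :
  tag x = tag y -> tagged x = tagged y :> nat -> x = y.
Proof.
case: x y => [p i] [q j] /= e; subst q => ij.
by congr existT; apply: val_inj.
Qed.

Lemma birth_lt_death (x : Defs.point D) : ((tag x).1%:E < (tag x).2)%E.
Proof.
case: x => -[b d] /= i; rewrite ltNge; apply/negP => db.
by have := leq_ltn_trans (leq0n _) (ltn_ord i); rewrite (diagram0 r db).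
Qed.

Lemma birth_countoo b : birth_count r b +oo%E = 0%N.
Proof.
apply/eqP; rewrite -leqn0.
have := @birth_count_le _ r b +oo%E (b - 1) (b + 1); rewrite subn0; apply.
  by rewrite ltrBlDr !ltrDl ltr01.
exact: ltry.
Qed.

Lemma birth_step_function b :
  step_function (birth_count r b) (fun d => D (b, d)) b%:E.
Proof.
split; [exact: birth_countoo|exact: birth_count_anti|exact: diagram0|].
exact: birth_count_jump.
Qed.

Lemma death_step_function d : step_function (rev_death_count d)
  (fun c => if c is c'%:E then D (- c', d) else 0%N) (- d)%E.
Proof.
split=> //.
- move=> [c||] c' dc; last by move: dc; rewrite ltNge leNye.
    case: c' => [c'||] //=; rewrite lee_fin => cc.
    by apply: death_count_homo; rewrite ?lerN2 // EFinN lteNl.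
  by case: c'.
- by move=> [c||] //; rewrite leeNr => dc; apply: diagram0.
- move=> [b||]; last by rewrite ltNge leNye.
    rewrite lteNl => db.
    have [a1 [a2 [/andP[a1b ba2] a2d h]]] := death_count_jump hr db.
    exists (- a2)%:E, (- a1)%:E; split.
    + by rewrite EFinN lteN2 a2d -EFinN lte_fin ltrNl.
    + by rewrite /above lte_fin ltrNr a1b.
    + move=> [c1||] c2 /andP[ac cb]; last 2 first.
        by rewrite ltNge leey in cb.
        by rewrite leNgt ltNyr in ac.
      rewrite lee_fin in ac; rewrite lte_fin in cb.
      case: c2 => [c2||] //; rewrite /above ?orbF ?lee_fin ?lte_fin //=.
      move=> bc ca; apply: h; first by rewrite lerNr ca ltrN2.
      by rewrite ltrN2 cb lerNl.
  (* The value [+oo] stands for births at [-oo]. There are none: the count vanishes at negative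
     parameters, hence on both sides of the would-be jump. *)
  move=> doo; have d0 : (-oo < Order.min 0 d)%E by rewrite lt_min ltNy0 /=; move: doo; rewrite lteNl.
  have [a [_]] := ereal_between d0; rewrite lt_min lte_fin => /andP[a0 ad].
  exists (- a)%:E, +oo%E; split.
  + by rewrite EFinN lteN2 ad ltry.
  + by rewrite /above orbT.
  + move=> [c||] [c'||] //; rewrite ?lee_fin /above ?eqxx //= => /andP[ac _] _ _.
    have ca : - c <= a by rewrite lerNl.
    rewrite death_count0 //; first exact: le_lt_trans a0.
    by apply: le_lt_trans ad; rewrite lee_fin.
Qed.

Definition birth_code (x : Defs.point D) : nat :=
  (right_limit (birth_count r (tag x).1) (tag x).2 + tagged x)%N.

(** In the reversed order a point born at [b] ends at [- b], so an earlier birth plays the part of a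
    later death. *)
Definition death_code (x : Defs.point D) : nat :=
  (right_limit (rev_death_count (tag x).2) (- (tag x).1)%:E + tagged x)%N.

Lemma birth_code_lt (x : Defs.point D) c :
  ((tag x).1%:E < c)%E -> (c < (tag x).2)%E ->
  (birth_code x < birth_count r (tag x).1 c)%N.
Proof.
case: x => -[b d] i /=.
exact: (code_lt (birth_step_function b) (ltn_ord i)).
Qed.

Lemma birth_code_ge (x : Defs.point D) c : above (tag x).2 c ->
  (birth_count r (tag x).1 c <= birth_code x)%N.
Proof.
case: x => -[b d] i /=.
exact: (code_ge (birth_step_function b) (ltn_ord i)).
Qed.

Lemma birth_code_exists b c n : (b%:E < c)%E -> (n < birth_count r b c)%N ->
  exists x : Defs.point D, (tag x).1 = b /\ birth_code x = n.
Proof.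
move=> bc nb.
have [e [j [je <-]]] := code_exists (birth_step_function b) bc nb.
by exists (existT _ (b, e) (Ordinal je)).
Qed.

Lemma birth_code_inj (x y : Defs.point D) : (tag x).1 = (tag y).1 ->
  birth_code x = birth_code y -> x = y.
Proof.
case: x y => -[b d] i [[b' d'] j] /= e; subst b' => ij.
have e := code_inj (birth_step_function b) (ltn_ord i) (ltn_ord j) ij.
by subst d'; apply: point_eq => //; move/addnI: ij.
Qed.

Lemma death_code_lt (x : Defs.point D) a :
  (tag x).1 < a -> (a%:E < (tag x).2)%E ->
  (death_code x < death_count r (tag x).2 a)%N.
Proof.
case: x => -[b d] i /= ba ad.
have ib : (i < D (- - b, d))%N by rewrite opprK.
have := @code_lt _ _ _ _ (death_step_function d) (- b)%:E i (- a)%:E ib.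
by rewrite /= opprK; apply; [rewrite EFinN lteN2|rewrite lte_fin ltrN2].
Qed.

Lemma death_code_ge (x : Defs.point D) a : a < (tag x).1 ->
  (death_count r (tag x).2 a <= death_code x)%N.
Proof.
case: x => -[b d] i /= ab.
have ib : (i < D (- - b, d))%N by rewrite opprK.
have := @code_ge _ _ _ _ (death_step_function d) (- b)%:E i (- a)%:E ib.
by rewrite /= opprK; apply; rewrite /above lte_fin ltrN2 ab.
Qed.

Lemma death_code_exists d a n : (a%:E < d)%E -> (n < death_count r d a)%N ->
  exists x : Defs.point D, (tag x).2 = d /\ death_code x = n.
Proof.
move=> ad nd.
have [||e [j [je <-]]] :=
  @code_exists _ _ _ _ (death_step_function d) (- a)%:E n.
- by rewrite EFinN lteN2.
- by rewrite /= opprK.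
case: e je => [b||] //= je; exists (existT _ (- b, d) (Ordinal je)).
by rewrite /death_code /= opprK.
Qed.

Lemma death_code_inj (x y : Defs.point D) : (tag x).2 = (tag y).2 ->
  death_code x = death_code y -> x = y.
Proof.
case: x y => -[b d] i [[b' d'] j] /= e; subst d' => ij.
have ib : (i < D (- - b, d))%N by rewrite opprK.
have jb : (j < D (- - b', d))%N by rewrite opprK.
have [/oppr_inj e] := code_inj (death_step_function d)
  (e := (- b)%:E) (e' := (- b')%:E) ib jb ij.
by subst b'; apply: point_eq => //; move/addnI: ij.
Qed.

End PointCodes.

(** * Matching of diagrams *)

Lemma above_sub (R : realType) (d c : \bar R) (x : R) :
  above (d + x%:E)%E c -> above d (c - x%:E)%E.
Proof.
case/orP => [dc|/andP[/eqP dx /eqP ->]]; first by rewrite /above lteBrDr // dc.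
by case: d dx.
Qed.

Lemma above_add (R : realType) (d c : \bar R) (x : R) :
  above d c -> above (d + x%:E)%E (c + x%:E)%E.
Proof.
case/orP => [dc|/andP[/eqP -> /eqP ->]]; last by rewrite /above orbC.
by rewrite /above lteD2rE // dc.
Qed.

Section Matching.
Variables (R : realType) (delta : R) (rM rI rN : R -> R -> nat).
Hypothesis delta0 : 0 <= delta.
Hypothesis hM : rank_function rM.
Hypothesis hI : rank_function rI.
Hypothesis hN : rank_function rN.
(** These are Frobenius' inequalities for four chains of maps. [MI1] and [MI2] start with M_a1 ->
    M_a2 and end with M_c -> N_(c + delta) and with N_(c + delta) -> M_(c + 2 delta). [IN1] and
    [IN2] start with M_a -> N_(a + delta) and with N_(a - delta) -> M_a and end with N_(c1 + delta)
    -> N_(c2 + delta). The variants in [oo] are the cases [c2 = +oo], where ranks are 0. *)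
Hypothesis MI1 : forall a1 a2 c, a1 <= a2 -> a2 < c ->
  (rI a2 c + rM a1 c <= rM a2 c + rI a1 c)%N.
Hypothesis MI2 : forall a1 a2 c, a1 <= a2 -> a2 < c ->
  (rM a2 (c + 2 * delta) + rI a1 c <= rI a2 c + rM a1 (c + 2 * delta))%N.
Hypothesis IN1 : forall a c1 c2, a < c1 -> c1 <= c2 ->
  (rI a c1 + rN (a + delta) (c2 + delta) <=
   rN (a + delta) (c1 + delta) + rI a c2)%N.
Hypothesis IN1oo : forall a c, a < c -> (rI a c <= rN (a + delta) (c + delta))%N.
Hypothesis IN2 : forall a c1 c2 : R, a < c1 -> c1 <= c2 ->
  (rN (a - delta) (c1 + delta) + rI a c2 <=
   rI a c1 + rN (a - delta) (c2 + delta))%N.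
Hypothesis IN2oo : forall a c : R, a < c -> (rN (a - delta) (c + delta) <= rI a c)%N.

Local Notation DM := (diagram_of_rank rM).
Local Notation DI := (diagram_of_rank rI).
Local Notation DN := (diagram_of_rank rN).

Lemma birth_count_MI (b c : R) : b < c ->
  (birth_count rI b c%:E <= birth_count rM b c%:E)%N.
Proof.
move=> bc; rewrite -lte_fin in bc.
have [a1 [a2 [/andP[a1b ba2] ac h]]] := birth_count_stable hM bc.
rewrite (h a1 a2) ?lexx ?a1b ?ba2 //; rewrite lte_fin in ac.
have a12 : a1 <= a2 by apply/ltW/(lt_trans a1b).
have := @birth_count_le _ rI b c%:E a1 a2; rewrite a1b ba2 lte_fin => /(_ isT ac).
move/leq_trans; apply; exact: leq_sub_cross (MI1 a12 ac).
Qed.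

Lemma birth_count_IM (b c : R) : b < c ->
  (birth_count rM b (c + 2 * delta)%:E <= birth_count rI b c%:E)%N.
Proof.
move=> bc; rewrite -lte_fin in bc.
have [a1 [a2 [/andP[a1b ba2] ac h]]] := birth_count_stable hI bc.
rewrite (h a1 a2) ?lexx ?a1b ?ba2 //; rewrite lte_fin in ac.
have a12 : a1 <= a2 by apply/ltW/(lt_trans a1b).
have acd : a2 < c + 2 * delta by apply: lt_le_trans ac _; rewrite lerDl mulr_ge0.
have := @birth_count_le _ rM b (c + 2 * delta)%:E a1 a2.
rewrite a1b ba2 lte_fin => /(_ isT acd).
move/leq_trans; apply; exact: leq_sub_cross (MI2 a12 ac).
Qed.

Lemma death_count_IN (d : \bar R) (a : R) : (a%:E < d)%E ->
  (death_count rI d a <= death_count rN (d + delta%:E) (a + delta))%N.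
Proof.
move=> ad; have ad' : ((a + delta)%:E < d + delta%:E)%E.
  by rewrite EFinD lteD2rE.
have [c1 [c2 [ac1 c1d dc2 h]]] := death_count_stable hN ad'.
rewrite (h c1 c2) ?lexx //.
case: c1 ac1 c1d {h} => [c1||] //; last by case: (d).
rewrite lte_fin => ac1 c1d.
have {}ac1 : a < c1 - delta by rewrite ltrBrDr.
have {}c1d : ((c1 - delta)%:E < d)%E by rewrite EFinB lteBlDr.
have dc2' : above d (c2 - delta%:E) by apply: above_sub.
have := @death_count_le _ rI d a (c1 - delta)%:E (c2 - delta%:E).
rewrite lte_fin => /(_ ac1 c1d dc2') /leq_trans; apply.
have c12 := lt_le_trans c1d (above_le dc2').
case: c2 {dc2 dc2'} c12 => [c2||] //= c12; last first.
  by rewrite !subn0; have := IN1oo ac1; rewrite subrK.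
have c12' : c1 - delta <= c2 - delta by apply: ltW.
by apply: leq_sub_cross; have := IN1 ac1 c12'; rewrite !subrK.
Qed.

Lemma death_count_NI (d : \bar R) (a : R) : (a%:E < d)%E ->
  (death_count rN (d + delta%:E) (a - delta) <= death_count rI d a)%N.
Proof.
move=> ad; have [c1 [c2 [ac1 c1d dc2 h]]] := death_count_stable hI ad.
rewrite (h c1 c2) ?lexx //.
case: c1 ac1 c1d {h} => [c1||] //; last by case: (d).
rewrite lte_fin => ac1 c1d.
have acd : a - delta < c1 + delta.
  by apply: le_lt_trans (lt_le_trans ac1 _); [rewrite gerBl|rewrite lerDl].
have cdd : ((c1 + delta)%:E < d + delta%:E)%E by rewrite EFinD lteD2rE.
have dc2' : above (d + delta%:E) (c2 + delta%:E) by apply: above_add.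
have := @death_count_le _ rN (d + delta%:E)%E (a - delta) (c1 + delta)%:E (c2 + delta%:E).
rewrite lte_fin => /(_ acd cdd dc2') /leq_trans; apply.
have c12 := lt_le_trans c1d (above_le dc2).
case: c2 {dc2 dc2'} c12 => [c2||] //= c12; last first.
  by rewrite !subn0; have := IN2oo ac1.
by apply: leq_sub_cross; apply: IN2 => //; apply: ltW.
Qed.

Let MI (x : Defs.point DM) (y : Defs.point DI) :=
  (tag x).1 = (tag y).1 /\ birth_code x = birth_code y.

Let IN (y : Defs.point DI) (z : Defs.point DN) :=
  (tag z).2 = ((tag y).2 + delta%:E)%E /\ death_code y = death_code z.

Lemma MI_right_total y : exists x, MI x y.
Proof.
have [c [bc cd]] := ereal_between (birth_lt_death y).
have [|x [xb xc]] := birth_code_exists (c := c%:E) (n := birth_code y) hM bc.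
  apply: leq_trans (birth_count_MI _); last by rewrite -lte_fin.
  exact: birth_code_lt.
by exists x; split; rewrite ?xb ?xc.
Qed.

(** A bar longer than [2 * delta] is alive at some [c] such that [c - 2 * delta] still follows its
    birth; [birth_count_IM] then yields a bar of I with the same birth and the same code. *)
Lemma MI_unmatched x : (forall y, ~ MI x y) ->
  ((tag x).2 <= (tag x).1%:E + (2 * delta)%:E)%E.
Proof.
move=> h; rewrite leNgt; apply/negP => bd.
have [c [bc cd]] := ereal_between bd.
have {}bc : (tag x).1 < c - 2 * delta by rewrite ltrBrDr -lte_fin EFinD.
have [||y [yb yc]] := birth_code_exists (b := (tag x).1)
  (c := (c - 2 * delta)%:E) (n := birth_code x) hI.
- by rewrite lte_fin.
- apply: leq_trans (birth_count_IM bc); rewrite subrK.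
  apply: birth_code_lt => //; rewrite lte_fin; apply: lt_le_trans bc _.
  by rewrite gerBl mulr_ge0.
by apply: (h y); split; rewrite ?yb ?yc.
Qed.

(** At a parameter separating the two deaths, suitably shifted, equal codes would contradict the
    comparison of the counts. *)
Lemma MI_death x y : MI x y -> ((tag y).2 <= (tag x).2)%E /\
  ((tag x).2 <= (tag y).2 + (2 * delta)%:E)%E.
Proof.
move=> [xy cxy]; split; rewrite leNgt; apply/negP.
  move=> /ereal_between[c [xc cy]].
  have bc : (tag x).1 < c by rewrite -lte_fin; apply: lt_trans xc; apply: birth_lt_death.
  have := @birth_code_ge _ _ hM x c%:E; rewrite /above xc => /(_ isT).
  have := @birth_code_lt _ _ hI y c%:E; rewrite -xy lte_fin => /(_ bc cy).
  have := birth_count_MI bc; rewrite cxy; clear; lia.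
move=> yx; have [c [yc cx]] := ereal_between yx.
have yc' : ((tag y).2 < (c - 2 * delta)%:E)%E by rewrite EFinB lteBrDr.
have bc : (tag x).1 < c - 2 * delta.
  by rewrite -lte_fin xy; apply: lt_trans yc'; apply: birth_lt_death.
have := @birth_code_ge _ _ hI y (c - 2 * delta)%:E; rewrite /above yc' => /(_ isT).
have := @birth_code_lt _ _ hM x c%:E; rewrite lte_fin.
have bc' : (tag x).1 < c by apply: lt_le_trans bc _; rewrite gerBl mulr_ge0.
move=> /(_ bc' cx).
have := birth_count_IM bc; rewrite subrK cxy -xy => h1 h2 h3.
by have := leq_trans h1 h3; rewrite leqNgt h2.
Qed.

Lemma IN_left_total y : exists z, IN y z.
Proof.
have [a [ba ad]] := ereal_between (birth_lt_death y).
have ad' : ((a + delta)%:E < (tag y).2 + delta%:E)%E by rewrite EFinD lteD2rE.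
have [|z [zd zc]] := death_code_exists (n := death_code y) hN ad'.
  apply: leq_trans (death_count_IN ad).
  by apply: death_code_lt => //; rewrite -lte_fin.
by exists z; split; rewrite ?zd ?zc.
Qed.

Lemma IN_unmatched z : (forall y, ~ IN y z) ->
  ((tag z).2 <= (tag z).1%:E + (2 * delta)%:E)%E.
Proof.
move=> h; rewrite leNgt; apply/negP => bd.
have [c [bc cd]] := ereal_between bd.
have {}bc : (tag z).1 < c - delta - delta.
  by rewrite -addrA -opprD ltrBrDr -mulr2n -mulr_natl -lte_fin EFinD.
have cd' : ((c - delta)%:E < (tag z).2 - delta%:E)%E.
  by rewrite EFinB lteD2rE.
have dd : ((tag z).2 - delta%:E + delta%:E = (tag z).2)%E by rewrite subeK.
have [|y [yd yc]] := death_code_exists (n := death_code z) hI cd'.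
  apply: leq_trans (death_count_NI cd'); rewrite dd.
  apply: death_code_lt => //; apply: le_lt_trans cd.
  by rewrite lee_fin -addrA -opprD gerBl addr_ge0.
by apply: (h y); split; rewrite ?yd ?yc.
Qed.

Lemma IN_birth y z : IN y z ->
  (tag z).1 <= (tag y).1 + delta /\ (tag y).1 <= (tag z).1 + delta.
Proof.
move=> [zy cyz]; split; rewrite leNgt; apply/negP => yz.
  (* The separating parameter must also precede the death of [y], as [death_count] is meaningful
     only there. *)
  have [a []] : exists a : R, ((tag y).1%:E < a%:E)%E /\
      (a%:E < Order.min (tag y).2 ((tag z).1 - delta)%:E)%E.
    by apply: ereal_between; rewrite lt_min birth_lt_death lte_fin ltrBrDr.
  rewrite lt_min !lte_fin ltrBrDr => ba /andP[ad az].
  have := death_count_IN ad; rewrite -zy.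
  have := death_code_lt hI ba ad; have := death_code_ge hN az.
  rewrite cyz => h1 h2 h3.
  by have := leq_trans h2 (leq_trans h3 h1); rewrite ltnn.
(* The midpoint precedes the birth of [y], while its shift by [- delta] follows the birth of [z]. *)
pose a := ((tag z).1 + delta + (tag y).1) / 2.
have za : (tag z).1 < a - delta by rewrite ltrBrDr midf_lt.
have ay : a < (tag y).1 by rewrite midf_lt.
have ad : (a%:E < (tag y).2)%E.
  by apply: lt_trans (birth_lt_death y); rewrite lte_fin.
have := death_count_NI ad; rewrite -zy.
have ad' : ((a - delta)%:E < (tag z).2)%E.
  rewrite zy EFinB lteBlDr // -addeA -EFinD; apply: lt_le_trans ad _.
  by rewrite leeDl // lee_fin addr_ge0.
have := death_code_lt hN za ad'; have := death_code_ge hI ay.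
rewrite cyz => h1 h2 h3.
  by have := leq_trans h2 (leq_trans h3 h1); rewrite ltnn.
Qed.

Lemma diagonal_dist_le (b : R) (d : \bar R) : (b%:E < d)%E ->
  (d <= b%:E + (2 * delta)%:E)%E -> (diagonal_dist (b, d) <= delta%:E)%E.
Proof.
case: d => [d||] // _; rewrite -EFinD lee_fin => dle.
rewrite /diagonal_dist /= -EFinB -EFinM lee_fin.
by rewrite ler_pdivrMr // mulrC lerBlDl.
Qed.

Lemma linf_dist_le (b b' : R) (d d' : \bar R) : (b%:E < d)%E ->
  b <= b' + delta -> b' <= b + delta ->
  (d <= d' + delta%:E)%E -> (d' <= d + delta%:E)%E ->
  (linf_dist (b, d) (b', d') <= delta%:E)%E.
Proof.
move=> bd h1 h2 h3 h4; rewrite /linf_dist ge_max /=; apply/andP; split.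
  by rewrite lee_fin ler_norml; apply/andP; split; lra.
rewrite /death_dist; case: eqP => [_|]; first by rewrite lee_fin.
case: d d' bd h3 h4 => [d||] [d'||] //= _.
by rewrite -!EFinD !lee_fin => h3 h4 _; rewrite ler_norml; apply/andP; split; lra.
Qed.

(** The two matchings are composed. Every bar of I is matched on both sides, so a point left over by
    the composite is left over by one factor; its length is at most [2 * delta], which puts it
    within [delta] of the diagonal. From M to I a death drops by between 0 and [2 * delta], and the
    shift by [delta] towards N centres this error at 0. *)
Lemma rank_matching : exists M, @is_matching R delta DM DN M.
Proof.
exists (fun x z => exists2 y, MI x y & IN y z); split.
- split=> [x z z' [y [xy cxy] [yz cyz]] [y' [xy' cxy'] [yz' cyz']]
          |x x' z [y [xy cxy] [yz cyz]] [y' [xy' cxy'] [yz' cyz']]].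
    have e : y = y'.
      by apply: (birth_code_inj hI); [rewrite -xy -xy'|rewrite -cxy -cxy'].
    subst y'; apply: (death_code_inj hN); first by rewrite yz yz'.
    by rewrite -cyz -cyz'.
  have e : y = y'.
    apply: (death_code_inj hI); last by rewrite cyz cyz'.
    have /(congr1 (fun t => (t - delta%:E)%E)) : ((tag y).2 + delta%:E = (tag y').2 + delta%:E)%E.
      by rewrite -yz -yz'.
    by rewrite !addeK.
  subst y'; apply: (birth_code_inj hM); first by rewrite xy xy'.
  by rewrite cxy cxy'.
- move=> x z [y xy yz]; have [yx xy2] := MI_death xy.
  have [zy yz1] := IN_birth yz; have [zy2 _] := yz; have [xy1 _] := xy.
  have bd := birth_lt_death x; move: bd.
  case: (tag x) xy1 yx xy2 => b d /= -> yx xy2.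
  case: (tag z) zy yz1 zy2 => b' d' /= zy yz1 -> bd.
  apply: linf_dist_le => //.
    apply: le_trans xy2 _; rewrite -addeA -EFinD leeD2l // lee_fin; lra.
  by rewrite leeD2r.
- move=> x hx; have h : forall y, ~ MI x y.
    by move=> y xy; have [z yz] := IN_left_total y; apply: (hx z); exists y.
  have := birth_lt_death x; have := MI_unmatched h.
  by case: (tag x) => b d /= h1 h2; apply: diagonal_dist_le.
- move=> z hz; have h : forall y, ~ IN y z.
    by move=> y yz; have [x xy] := MI_right_total y; apply: (hz x); exists y.
  have := birth_lt_death z; have := IN_unmatched h.
  by case: (tag z) => b d /= h1 h2; apply: diagonal_dist_le.
Qed.

End Matching.

(** * Interleaved filtrations *)

Lemma rank_function_eq (R : realType) (r r' : R -> R -> nat) :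
  (forall a c, a < c -> r' a c = r a c) -> rank_function r -> rank_function r'.
Proof.
move=> rr [h1 h2 h3 h4]; split.
- move=> a1 a2 c a12 ac; rewrite !rr ?h1 //; exact: le_lt_trans ac.
- move=> a c1 c2 ac c12; rewrite !rr ?h2 //; exact: lt_le_trans c12.
- move=> a1 a2 c1 c2 a12 ac c12.
  have ac1 := le_lt_trans a12 ac.
  by rewrite !rr ?h3 //; apply: lt_le_trans c12.
- by move=> a c a0 ac; rewrite rr ?h4.
Qed.

Section HomologyRank.
Variables (F : fieldType) (T : choiceType).
Implicit Types (K L : set {fset T}).

Definition hrk k K L := rk (@cycles F T K k) (@boundaries F T L k).
Definition hfinite k K L := finite_mod (@cycles F T K k) (@boundaries F T L k).

Lemma hfiniteS k K L K' L' : K `<=` K' -> L' `<=` L ->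
  hfinite k K' L' -> hfinite k K L.
Proof. by move=> KK LL; apply: finite_modS; [exact: cyclesS|exact: boundariesS]. Qed.

Lemma leq_hrk k K L K' L' : K `<=` K' -> L' `<=` L ->
  hfinite k K' L' -> (hrk k K L <= hrk k K' L')%N.
Proof.
move=> KK LL; apply: leq_rk; do ?exact: subspace_boundaries.
  exact: cyclesS.
exact: boundariesS.
Qed.

Lemma hrk_frobenius k K K' L L' : K `<=` K' -> L `<=` L' -> hfinite k K' L ->
  (hrk k K L + hrk k K' L' <= hrk k K' L + hrk k K L')%N.
Proof.
move=> KK LL; apply: rk_frobenius; do ?exact: subspace_boundaries.
- exact: subspace_cycles.
- exact: cyclesS.
- exact: boundariesS.
Qed.

Lemma hrk_empty k K L : (forall s, ~ K s) -> hrk k K L = 0%N.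
Proof.
move=> K0.
have E n : dim_mod_ge (@cycles F T K k) (@boundaries F T L k) n <-> n = 0%N.
  by apply: dim_mod_ge_empty => s /K0.
apply: xget_unique => [|n [/E]] //.
by split; [exact/E|move=> /E].
Qed.

Lemma rank_function_hrk (R : realType) (A B : filtration R T) k :
  (forall a b, a <= b -> A a `<=` A b) -> (forall a b, a <= b -> B a `<=` B b) ->
  (forall a s, a < 0 -> ~ A a s) ->
  (forall a c, a < c -> hfinite k (A a) (B c)) ->
  rank_function (fun a c => hrk k (A a) (B c)).
Proof.
move=> hA hB A0 fin; split.
- move=> a1 a2 c a12 ac; apply: leq_hrk => //; [exact: hA|exact: fin].
- move=> a c1 c2 ac c12; apply: leq_hrk => //; [exact: hB|exact: fin].
- by move=> a1 a2 c1 c2 a12 ac c12; apply: hrk_frobenius; [apply: hA|apply: hB|apply: fin].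
- by move=> a c a0 _; apply: hrk_empty => s; apply: A0.
Qed.

End HomologyRank.

(* A diagram depends on the ranks at [a < c] only, and [rN] need not agree with
   those of [N] elsewhere. *)
Lemma interleaving_matching (R : realType) (F : fieldType) (T : choiceType)
    (M N : filtration R T) (k : nat) (eps : R) (rN : R -> R -> nat) :
  0 <= eps ->
  (forall a b, a <= b -> M a `<=` M b) -> (forall a b, a <= b -> N a `<=` N b) ->
  (forall a s, a < 0 -> ~ M a s) -> (forall a s, a < 0 -> ~ N a s) ->
  (forall a, M a `<=` N (a + eps)) -> (forall a, N a `<=` M (a + eps)) ->
  (forall a c, a < c -> hfinite F k (M a) (M c)) ->
  (forall a c, a < c -> hfinite F k (N a) (N c)) ->
  (forall a c, a < c -> rN a c = hrk F k (N a) (N c)) ->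
  exists X, @is_matching R eps
    (diagram_of_rank (fun a c => hrk F k (M a) (M c))) (diagram_of_rank rN) X.
Proof.
move=> eps0 hM hN M0 N0 MN NM fM fN rNE.
have Nshift a b : a <= b -> N (a + eps) `<=` N (b + eps).
  by move=> ab; apply: hN; rewrite lerD2r.
have NM' a : N (a - eps) `<=` M a by have := NM (a - eps); rewrite subrK.
have NM2 a : N (a + eps) `<=` M (a + 2 * eps).
  by rewrite (_ : a + 2 * eps = a + eps + eps) //; ring.
(* The map from [M a] to [N (c + eps)] passes through [M c], so its rank is finite. *)
have fI a c : a < c -> hfinite F k (M a) (N (c + eps)).
  by move=> ac; apply: hfiniteS (fM _ _ ac).
apply: (@rank_matching _ eps _ (fun a c => hrk F k (M a) (N (c + eps))) rN) => //.
- exact: rank_function_hrk.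
- by apply: (@rank_function_hrk F T R M (fun c => N (c + eps))).
- by apply: rank_function_eq rNE _; apply: rank_function_hrk.
- move=> a1 a2 c a12 ac; rewrite addnC; apply: hrk_frobenius; [exact: hM|exact: MN|exact: fM].
- move=> a1 a2 c a12 ac; rewrite addnC; apply: hrk_frobenius; [exact: hM|exact: NM2|exact: fI].
- move=> a c1 c2 ac c12; rewrite !rNE ?ltrD2r //; last exact: lt_le_trans c12.
  apply: hrk_frobenius; [exact: MN|exact: Nshift|].
  by apply: fN; rewrite ltrD2r.
- move=> a c ac; rewrite rNE ?ltrD2r //; apply: leq_hrk; [exact: MN|by []|].
  by apply: fN; rewrite ltrD2r.
- move=> a c1 c2 ac c12.
  have ac' c : a < c -> a - eps < c + eps.
    by move=> h; apply: le_lt_trans (lt_le_trans h _); rewrite ?gerBl ?lerDl.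
  rewrite !rNE ?ac' //; last exact: lt_le_trans c12.
  by apply: hrk_frobenius; [exact: NM'|exact: Nshift|exact: fI].
- move=> a c ac.
  have ac' : a - eps < c + eps.
    by apply: le_lt_trans (lt_le_trans ac _); rewrite ?gerBl ?lerDl.
  by rewrite rNE //; apply: leq_hrk; [exact: NM'|by []|exact: fI].
Qed.

(** * Rips and Cech filtrations under a quasi-isometry *)

Section Filtrations.
Variables (R : realType) (lambda : filtration_kind).

Lemma complex_filtration_of (X : metricType R) (S : set X) r :
  complex (filtration_of lambda S r).
Proof.
case: lambda => s t /= [s0 sS h] t0 ts; split=> //.
- by move=> v /(fsubsetP ts) /sS.
- by move=> x y /(fsubsetP ts) xs /(fsubsetP ts) ys; apply: h.
- by move=> v /(fsubsetP ts) /sS.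
- by case: h => z Sz hz; exists z => // x /(fsubsetP ts); apply: hz.
Qed.

Lemma filtration_ofS (X : metricType R) (S : set X) r r' : r <= r' ->
  filtration_of lambda S r `<=` filtration_of lambda S r'.
Proof.
move=> rr; case: lambda => s /= [s0 sS h]; split=> //.
- by move=> x y xs ys; apply: le_trans rr; apply: h.
- by case: h => z Sz hz; exists z => // x xs; apply: le_trans rr; apply: hz.
Qed.

Lemma filtration_of_lt0 (X : metricType R) (S : set X) r s : r < 0 ->
  ~ filtration_of lambda S r s.
Proof.
move=> r0; case: lambda => /= -[/fset0Pn[x xs] _].
  by move=> /(_ x x xs xs) h; have := le_lt_trans h r0; rewrite ltNge mdist_ge0.
by case=> z _ /(_ x xs) h; have := le_lt_trans h r0; rewrite ltNge mdist_ge0.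
Qed.

Variables (X Y : metricType R) (eps : R) (phi : X -> Y) (S : set X).
Hypothesis qi : quasi_isometry eps phi.

Let pull r := preimage_complex phi S (filtration_of lambda (phi @` S) r).

Lemma mdist_image x y r : mdist x y <= r -> mdist (phi x) (phi y) <= r + eps.
Proof. by have := qi x y; rewrite ler_norml => /andP[h1 h2] h; lra. Qed.

Lemma mdist_preimage x y r : mdist (phi x) (phi y) <= r -> mdist x y <= r + eps.
Proof. by have := qi x y; rewrite ler_norml => /andP[h1 h2] h; lra. Qed.

Lemma filtration_of_pull r : filtration_of lambda S r `<=` pull (r + eps).
Proof.
move=> s Ks; have [s0 sS] : s != fset0 /\ [set` s] `<=` S.
  by move: Ks; case: lambda => -[].
split=> //.
have is0 : (phi @` s)%fset != fset0.
  by have /fset0Pn[x xs] := s0; apply/fset0Pn; exists (phi x); apply: in_imfset.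
have isS : [set` (phi @` s)%fset] `<=` phi @` S.
  by move=> _ /imfsetP[x /= /sS xS ->]; exists x.
move: Ks; case: lambda => -[_ _ h]; split=> //.
  by move=> _ _ /imfsetP[x /= xs ->] /imfsetP[y /= ys ->]; apply/mdist_image/h.
case: h => z Sz h; exists (phi z); first by exists z.
by move=> _ /imfsetP[x /= xs ->]; apply/mdist_image/h.
Qed.

(** In the Cech case the balls are intrinsic: their common point belongs to the image of [S], and
    any of its preimages in [S] is a common point of the enlarged balls. *)
Lemma pull_filtration_of r : pull r `<=` filtration_of lambda S (r + eps).
Proof.
move=> s [s0 sS Ks].
have im x : x \in s -> phi x \in (phi @` s)%fset by apply: in_imfset.
move: Ks; case: lambda => -[_ _ h]; split=> //.
  by move=> x y xs ys; apply/mdist_preimage/h; apply: im.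
case: h => _ [z Sz <-] h; exists z => // x xs.
by apply/mdist_preimage/h/im.
Qed.

End Filtrations.

Theorem proposition5 (R : realType) (F : fieldType) (X Y : metricType R)
    (eps : R) (phi : X -> Y) (lambda : filtration_kind) (S : set X) :
  0 <= eps ->
  quasi_isometry eps phi ->
  diagrams_defined F (filtration_of lambda S) ->
  diagrams_defined F (filtration_of lambda (phi @` S)) ->
  (bottleneck_all (persistence F (filtration_of lambda S))
     (persistence F (filtration_of lambda (phi @` S))) <= eps%:E)%E.
Proof.
move=> eps0 qi dM dN.
apply: ub_ereal_sup => _ [k _ <-]; apply: ereal_inf_lbound.
exists eps => //; split=> //.
set K := filtration_of lambda (phi @` S).
have KS r s : K r s -> s != fset0 /\ [set` s] `<=` phi @` S.
  by rewrite /K; case: (lambda) => -[].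
pose N r := preimage_complex phi S (K r).
have NK a c n : a < c ->
    dim_mod_ge (@cycles F X (N a) k) (@boundaries F X (N c) k) n <->
    dim_mod_ge (@cycles F Y (K a) k) (@boundaries F Y (K c) k) n.
  move=> ac; apply: dim_mod_ge_preimage.
  - exact: complex_filtration_of.
  - exact: complex_filtration_of.
  - by apply: filtration_ofS; apply: ltW.
  - exact: KS.
apply: (@interleaving_matching R F X (filtration_of lambda S) N) => //.
- exact: filtration_ofS.
- by move=> a b ab; apply: preimage_complexS; apply: filtration_ofS.
- exact: filtration_of_lt0.
- by move=> a s a0 [_ _]; apply: filtration_of_lt0.
- exact: filtration_of_pull.
- exact: pull_filtration_of.
- by move=> a c; apply: dM.
- by move=> a c ac; have [n hn] := dN k a c ac; exists n; rewrite NK.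
- move=> a c ac; rewrite /homology_rank /hrk /rk; congr xget.
  by apply/seteqP; split=> n /=; rewrite !NK.
Qed.
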